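(* Let $K = 1.6$. There exist $\tau \in [\underline{\tau}, \overline{\tau}]$ and a $2\pi$-periodic $C^1$ function $x:\mathbb{R}\to\mathbb{R}$ such that $$x'(t) = -\frac{K}{\tau}\,\sin\bigl(x(t-\tau)\bigr)\qquad\text{for all } t\in\mathbb{R},$$ and such that the sequence of Fourier coefficients of $x$ belongs to the set $X_3$.
   Context: Fourier coefficients $c=(c_n)_{n\in\mathbb{Z}}$ of a $2\pi$-periodic function $x$ are those with $x(t)=\sum_{n\in\mathbb{Z}} c_n e^{int}$. For $\beta>0$ let $X_\beta = \{x:\mathbb{Z}\to\mathbb{C} : |x_n|\le \frac{\beta}{(|n|+1)^2} \text{ and } x_n=\overline{x_{-n}} \text{ for all } n\in\mathbb{Z}\}$. The sequence $\hat c:\mathbb{Z}\to\mathbb{C}$ is defined by $\hat c_0=0$, $\hat c_1=-0.1521000000-0.1163508047\,i$, $\hat c_2=0$, $\hat c_3=0.0001123121-0.0002746107\,i$, $\hat c_4=0$, $\hat c_5=-0.0000008173-0.0000001014\,i$, $\hat c_n=0$ for $n>5$, and $\hat c_n=\overline{\hat c_{-n}}$ for $n<0$. Further, $\hat\tau=1.570796$, $\Delta\tau=0.000001$, $\underline{\tau}=\hat\tau-\Delta\tau$, $\overline{\tau}=\hat\tau+\Delta\tau$, $\beta_2=0.0000002438$, $X_2=\hat c+X_{\beta_2}$ and $X_3=\{y\in X_2 : y_1-\hat c_1\in\mathbb{R}\}$. *)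

(* Defs.v *)
From Stdlib Require Import Reals ZArith.
From Coquelicot Require Import Coquelicot.

Open Scope R_scope.

(* e^{i theta} *)
Definition cis (theta : R) : C := (cos theta, sin theta).

(* Convergence of a bilateral series means that the parts indexed by n >= 0
   and by n < 0 both converge. *)
Definition is_bilateral_series (a : Z -> C) (s : C) : Prop :=
  exists sp sn : C,
    is_series (fun k : nat => a (Z.of_nat k)) sp /\
    is_series (fun k : nat => a (- Z.of_nat (S k))%Z) sn /\
    s = (sp + sn)%C.

Definition is_fourier_coeffs (x : R -> R) (c : Z -> C) : Prop :=
  forall t : R,
    is_bilateral_series (fun n : Z => (c n * cis (IZR n * t))%C) (RtoC (x t)).

Definition is_periodic (T : R) (x : R -> R) : Prop :=
  forall t : R, x (t + T) = x t.

Definition is_C1 (x : R -> R) : Prop :=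
  forall t : R, ex_derive x t /\ continuous (Derive x) t.

Definition Xball (beta : R) (x : Z -> C) : Prop :=
  forall n : Z,
    Cmod (x n) <= beta / (Rabs (IZR n) + 1) ^ 2 /\
    x n = Cconj (x (- n)%Z).

Definition chat_pos (n : positive) : C :=
  match n with
  | 1%positive => (-0.1521000000, -0.1163508047)
  | 3%positive => (0.0001123121, -0.0002746107)
  | 5%positive => (-0.0000008173, -0.0000001014)
  | _ => RtoC 0
  end.

Definition chat (n : Z) : C :=
  match n with
  | Z0 => RtoC 0
  | Zpos p => chat_pos p
  | Zneg p => Cconj (chat_pos p)
  end.

Definition tau_hat : R := 1.570796.
Definition Delta_tau : R := 0.000001.
Definition tau_lower : R := tau_hat - Delta_tau.
Definition tau_upper : R := tau_hat + Delta_tau.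

Definition beta2 : R := 0.0000002438.

Definition X2 (y : Z -> C) : Prop :=
  exists x : Z -> C, Xball beta2 x /\ forall n : Z, y n = (chat n + x n)%C.

Definition X3 (y : Z -> C) : Prop :=
  X2 y /\ Im (y 1%Z - chat 1%Z)%C = 0.

(* Main.v *)
Require Import Defs.
From Stdlib Require Import Reals ZArith Lia Lra Psatz Ranalysis5.
From Coquelicot Require Import Coquelicot.
Open Scope R_scope.

(** The delay can be taken to be exactly a quarter of the period, [tau = PI / 2]
(the observation of Kaplan and Yorke). If [x (t + PI) = - x t], then [x] and
[y t = x (t - PI / 2)] satisfy the Hamiltonian system [x' = - A sin y],
[y' = A sin x] with [A = K / tau = 3.2 / PI]. In the variables
[u = (x + y) / 2] and [v = (x - y) / 2] it becomes [u' = A cos u sin v],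
[v' = - A sin u cos v], and [u] is half the angle of a pendulum. Its Fourier
series is known in closed form: for a parameter [lam > 0],

  [u t] is the sum over all odd integers [k] of [sin (k t) / (k cosh (lam k))],

and [v t = u (t + PI / 2)]. Hence [x = u + v] is an explicit function of the
single parameter [lam], and no fixed point theorem is needed.

The equation is checked by multiplying Fourier series. Put [C = u'] and let
[D], [S] be the series with coefficients [1 / cosh (lam j)] at even [j] and
[1 / sinh (lam j)] at odd [j]; up to normalisation [C], [D], [S] are the
elliptic functions cn, dn, sn. By the addition formulas of cosh and sinh, each
coefficient of a product is a sum of differences that telescopes. This gives
[S' = C D] and [D' = - C S] ([cn_theta_conv]), so that [D + i S] turns with
angular speed [C = u'], and [D = D 0 * cos u], [S = D 0 * sin u]
([angle_polar]). A second telescoping sum ([quarter_conv]) shows that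
[D t * S (t + PI / 2)] is a constant multiple of [C t], which is
[u' = A cos u sin v] for some constant [A] ([cn_speed]). The same identity a
quarter period later gives [v'], and their sum is the delay equation
([orbit_derive]).

The constant is [A = D 0 * C 0 / S (PI / 2)], a quotient of series in the nome
[q = exp (- 2 lam)] that converge fast. By the intermediate value theorem it
takes the value [3.2 / PI] for some [q] between 0.004626503 and 0.004626505
([tuned_parameter]).

The coefficients of [x] vanish at even indices and have modulus
[sqrt 2 / (n cosh (lam n))] at odd [n]. A translation in time gives the first
one the prescribed imaginary part; its modulus then determines its real part,
which lies within 6e-8 of -0.1521. The third and fifth are rational functions
of [q] times polynomials in the first one, and are enclosed numerically. From
the seventh on, the coefficients are below the allowed error by themselves:
about 2.72e-9 against 3.81e-9 at index 7, and far less afterwards. *)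

(** * Bilateral sums of geometrically decaying sequences *)

(** Summing the terms at [n] and [- n] together makes an odd sequence vanish
term by term and leaves a single one-sided series to handle. *)
Definition pairs (f : Z -> R) (n : nat) : R :=
  match n with
  | O => f 0%Z
  | S _ => f (Z.of_nat n) + f (- Z.of_nat n)%Z
  end.

Definition zsum (f : Z -> R) : R := Series (pairs f).

(** Geometric decay survives shifts, bounded factors and multiplication by the
index, so every series below and every termwise derivative stays in this
class. *)
Definition decays (f : Z -> R) : Prop :=
  exists K eta : R, 0 <= K /\ 0 < eta < 1 /\
    forall n : Z, Rabs (f n) <= K * eta ^ Z.abs_nat n.

Lemma abs_nat_opp (n : Z) : Z.abs_nat (- n) = Z.abs_nat n.
Proof. lia. Qed.

Lemma pairs_bound (f : Z -> R) (K eta : R) (hK : 0 <= K) (heta : 0 < eta)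
  (hf : forall n, Rabs (f n) <= K * eta ^ Z.abs_nat n) (n : nat) :
  Rabs (pairs f n) <= 2 * K * eta ^ n.
Proof.
  assert (0 <= eta ^ n) by (apply pow_le; lra).
  destruct n as [|n].
  - generalize (hf 0%Z). simpl. nra.
  - unfold pairs. eapply Rle_trans; [apply Rabs_triang|].
    generalize (hf (Z.of_nat (S n))), (hf (- Z.of_nat (S n))%Z).
    rewrite abs_nat_opp, !Zabs2Nat.id. lra.
Qed.

Lemma is_series_geom_scal (K eta : R) (heta : 0 < eta < 1) :
  is_series (fun n => K * eta ^ n) (K / (1 - eta)).
Proof.
  apply (@is_series_scal R_AbsRing R_NormedModule K (fun n => eta ^ n) (/ (1 - eta))).
  apply is_series_geom. rewrite Rabs_pos_eq; lra.
Qed.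

Lemma decays_ex_series_abs (f : Z -> R) :
  decays f -> ex_series (fun n => Rabs (pairs f n)).
Proof.
  intros [K [eta [hK [heta hf]]]].
  apply (@ex_series_le R_AbsRing R_CompleteNormedModule _ (fun n => 2 * K * eta ^ n)).
  - intros n. change (Rabs (Rabs (pairs f n)) <= 2 * K * eta ^ n).
    rewrite Rabs_Rabsolu. apply pairs_bound; tauto.
  - eexists. apply is_series_geom_scal. assumption.
Qed.

Lemma decays_ex_series (f : Z -> R) : decays f -> ex_series (pairs f).
Proof. intros h. apply ex_series_Rabs, decays_ex_series_abs, h. Qed.

Lemma decays_is_series (f : Z -> R) : decays f -> is_series (pairs f) (zsum f).
Proof. intros h. apply Series_correct, decays_ex_series, h. Qed.

Lemma decays_cvg (f : Z -> R) : decays f -> is_lim_seq (sum_n (pairs f)) (zsum f).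
Proof. exact (decays_is_series f). Qed.

(** A bound linear in the constant [K]: applied to a difference of sequences, it
turns termwise estimates into estimates between sums. *)
Lemma zsum_bound (f : Z -> R) (K eta : R) (hK : 0 <= K) (heta : 0 < eta < 1)
  (hf : forall n, Rabs (f n) <= K * eta ^ Z.abs_nat n) :
  Rabs (zsum f) <= 2 * K / (1 - eta).
Proof.
  assert (decays f) by (exists K, eta; tauto).
  eapply Rle_trans; [apply Series_Rabs, decays_ex_series_abs; assumption|].
  rewrite <- (is_series_unique _ _ (is_series_geom_scal (2 * K) eta heta)).
  apply Series_le.
  - intros n. split; [apply Rabs_pos|]. apply pairs_bound; tauto.
  - eexists. apply is_series_geom_scal. assumption.
Qed.

Lemma pairs_ext (f g : Z -> R) (h : forall n, f n = g n) (n : nat) :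
  pairs f n = pairs g n.
Proof. destruct n; simpl; rewrite ?h; reflexivity. Qed.

Lemma zsum_ext (f g : Z -> R) : (forall n, f n = g n) -> zsum f = zsum g.
Proof. intros h. apply Series_ext. intros n. apply pairs_ext, h. Qed.

Lemma zsum_plus (f g : Z -> R) :
  decays f -> decays g -> zsum (fun n => f n + g n) = zsum f + zsum g.
Proof.
  intros hf hg. unfold zsum. rewrite <- Series_plus by (apply decays_ex_series; assumption).
  apply Series_ext. intros [|n]; simpl; ring.
Qed.

Lemma zsum_scal (k : R) (f : Z -> R) : zsum (fun n => k * f n) = k * zsum f.
Proof.
  unfold zsum. rewrite <- Series_scal_l. apply Series_ext. intros [|n]; simpl; ring.
Qed.

Lemma zsum_odd (f : Z -> R) (h : forall n, f (- n)%Z = - f n) : zsum f = 0.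
Proof.
  unfold zsum. rewrite (Series_ext _ (fun _ => 0 * 0)).
  - rewrite Series_scal_l. ring.
  - intros [|n]; unfold pairs.
    + generalize (h 0%Z). simpl. lra.
    + rewrite h. ring.
Qed.

Lemma decays_ext (f g : Z -> R) : (forall n, f n = g n) -> decays f -> decays g.
Proof.
  intros h [K [eta [hK [heta hf]]]]. exists K, eta. repeat split; try tauto.
  intros n. rewrite <- h. apply hf.
Qed.

Lemma decays_le (f g : Z -> R) : (forall n, Rabs (g n) <= Rabs (f n)) -> decays f -> decays g.
Proof.
  intros h [K [eta [hK [heta hf]]]]. exists K, eta. repeat split; try tauto.
  intros n. eapply Rle_trans; [apply h|apply hf].
Qed.

Lemma decays_mult_bounded (f e : Z -> R) (he : forall n, Rabs (e n) <= 1) :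
  decays f -> decays (fun n => f n * e n).
Proof.
  apply decays_le. intros n. rewrite Rabs_mult.
  generalize (Rabs_pos (f n)), (he n). nra.
Qed.

Lemma decays_scal (k : R) (f : Z -> R) : decays f -> decays (fun n => k * f n).
Proof.
  intros [K [eta [hK [heta hf]]]]. exists (Rabs k * K), eta.
  repeat split; try tauto.
  - apply Rmult_le_pos; [apply Rabs_pos|assumption].
  - intros n. rewrite Rabs_mult, Rmult_assoc.
    apply Rmult_le_compat_l; [apply Rabs_pos|apply hf].
Qed.

Lemma decays_plus (f g : Z -> R) : decays f -> decays g -> decays (fun n => f n + g n).
Proof.
  intros [K [eta [hK [heta hf]]]] [K' [eta' [hK' [heta' hg]]]].
  exists (K + K'), (Rmax eta eta').
  assert (h1 := Rmax_l eta eta'). assert (h2 := Rmax_r eta eta').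
  repeat split; try lra.
  - apply Rmax_lub_lt; lra.
  - intros n. eapply Rle_trans; [apply Rabs_triang|].
    specialize (hf n). specialize (hg n).
    assert (a1 : eta ^ Z.abs_nat n <= Rmax eta eta' ^ Z.abs_nat n) by (apply pow_incr; lra).
    assert (a2 : eta' ^ Z.abs_nat n <= Rmax eta eta' ^ Z.abs_nat n) by (apply pow_incr; lra).
    nra.
Qed.

Lemma pow_le_antitone (a : R) (m n : nat) : 0 < a < 1 -> (m <= n)%nat -> a ^ n <= a ^ m.
Proof.
  intros ha h. replace n with (m + (n - m))%nat by lia. rewrite pow_add.
  assert (0 < a ^ m) by (apply pow_lt; lra).
  assert (a ^ (n - m) <= 1).
  { rewrite <- (pow1 (n - m)). apply pow_incr. lra. }
  assert (0 < a ^ (n - m)) by (apply pow_lt; lra).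
  nra.
Qed.

Lemma decays_shift (f : Z -> R) (k : Z) : decays f -> decays (fun n => f (n + k)%Z).
Proof.
  intros [K [eta [hK [heta hf]]]].
  assert (hp : 0 < eta ^ Z.abs_nat k) by (apply pow_lt; lra).
  exists (K / eta ^ Z.abs_nat k), eta. repeat split; try tauto.
  - apply Rmult_le_pos; [assumption|]. left. apply Rinv_0_lt_compat, hp.
  - intros n. eapply Rle_trans; [apply hf|].
    unfold Rdiv. rewrite Rmult_assoc. apply Rmult_le_compat_l; [assumption|].
    apply (Rmult_le_reg_l _ _ _ hp). rewrite <- Rmult_assoc, Rinv_r, Rmult_1_l by lra.
    rewrite <- pow_add. apply pow_le_antitone; [assumption|lia].
Qed.

Lemma decays_reflect (f : Z -> R) : decays f -> decays (fun n => f (- n)%Z).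
Proof.
  intros [K [eta [hK [heta hf]]]]. exists K, eta. repeat split; try tauto.
  intros n. specialize (hf (- n)%Z). rewrite abs_nat_opp in hf. exact hf.
Qed.

Lemma sqrt_unit (eta : R) : 0 < eta < 1 -> 0 < sqrt eta < 1.
Proof.
  intros h. split.
  - apply sqrt_lt_R0. lra.
  - rewrite <- sqrt_1. apply sqrt_lt_1_alt. lra.
Qed.

Lemma pow_sqrt (eta : R) (n : nat) :
  0 < eta -> eta ^ n = sqrt eta ^ n * sqrt eta ^ n.
Proof. intros h. rewrite <- Rpow_mult_distr, sqrt_sqrt by lra. reflexivity. Qed.

(** Bernoulli's inequality for the powers of [/ eta]. *)
Lemma INR_pow_bound (eta : R) (n : nat) :
  0 < eta < 1 -> INR n * eta ^ n <= / (1 - eta).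
Proof.
  intros h.
  assert (hq : 0 < / eta - 1).
  { apply Rlt_0_minus. rewrite <- Rinv_1 at 1. apply Rinv_lt_contravar; lra. }
  assert (hb : 1 + INR n * (/ eta - 1) <= (/ eta) ^ n).
  { generalize (poly n (/ eta - 1) hq). intros h0.
    replace (1 + (/ eta - 1)) with (/ eta) in h0 by ring. exact h0. }
  assert (hp : 0 < eta ^ n) by (apply pow_lt; lra).
  assert (he : eta ^ n * (/ eta) ^ n = 1).
  { rewrite <- Rpow_mult_distr, Rinv_r by lra. apply pow1. }
  assert (hI : 0 <= INR n) by apply pos_INR.
  assert (INR n * eta ^ n * (/ eta - 1) <= 1) by nra.
  apply (Rmult_le_reg_r (1 - eta)); [lra|]. rewrite Rinv_l by lra.
  replace (INR n * eta ^ n * (1 - eta)) with (INR n * eta ^ n * (/ eta - 1) * eta).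
  - nra.
  - field. lra.
Qed.

Lemma Rabs_IZR_abs_nat (n : Z) : Rabs (IZR n) = INR (Z.abs_nat n).
Proof. rewrite <- abs_IZR, INR_IZR_INZ, Nat2Z.inj_abs_nat. reflexivity. Qed.

(** One factor [sqrt eta ^ n] absorbs the index, the other one keeps the decay. *)
Lemma decays_index (f : Z -> R) : decays f -> decays (fun n => IZR n * f n).
Proof.
  intros [K [eta [hK [heta hf]]]].
  destruct (sqrt_unit eta heta) as [s0 s1].
  exists (K / (1 - sqrt eta)), (sqrt eta). repeat split; try lra.
  - apply Rmult_le_pos; [assumption|]. left. apply Rinv_0_lt_compat. lra.
  - intros n. rewrite Rabs_mult, Rabs_IZR_abs_nat.
    specialize (hf n). rewrite (pow_sqrt eta) in hf by lra.
    assert (hb := INR_pow_bound (sqrt eta) (Z.abs_nat n) (conj s0 s1)).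
    set (p := sqrt eta ^ Z.abs_nat n) in *.
    assert (0 < p) by (apply pow_lt; lra).
    assert (0 <= INR (Z.abs_nat n)) by apply pos_INR.
    unfold Rdiv.
    apply Rle_trans with (INR (Z.abs_nat n) * (K * (p * p))); [nra|].
    replace (INR (Z.abs_nat n) * (K * (p * p))) with (K * p * (INR (Z.abs_nat n) * p)) by ring.
    replace (K * / (1 - sqrt eta) * p) with (K * p * / (1 - sqrt eta)) by ring.
    apply Rmult_le_compat_l; [nra|assumption].
Qed.

Lemma lim_seq_inj (u : nat -> R) (a b : R) :
  is_lim_seq u a -> is_lim_seq u b -> a = b.
Proof. intros h1 h2. apply is_lim_seq_unique in h1, h2. congruence. Qed.

Lemma sum_pairs_shift (f : Z -> R) (m : nat) :
  sum_n (pairs (fun n => f (n + 1)%Z)) m =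
  sum_n (pairs f) m + (f (Z.of_nat m + 1)%Z - f (- Z.of_nat m)%Z).
Proof.
  induction m as [|m IH].
  - rewrite !sum_O. simpl. ring.
  - rewrite !sum_Sn, IH. unfold pairs.
    replace (- Z.of_nat (S m) + 1)%Z with (- Z.of_nat m)%Z by lia.
    replace (Z.of_nat m + 1)%Z with (Z.of_nat (S m)) by lia.
    unfold plus. cbn -[Z.of_nat Z.add Z.opp]. ring.
Qed.

Lemma decays_tail (f : Z -> R) : decays f -> is_lim_seq (fun m => f (Z.of_nat m)) 0.
Proof.
  intros [K [eta [hK [heta hf]]]].
  apply is_lim_seq_abs_0.
  apply is_lim_seq_le_le with (u := fun _ => 0) (w := fun m => K * eta ^ m).
  - intros m. split; [apply Rabs_pos|].
    eapply Rle_trans; [apply hf|]. rewrite Zabs2Nat.id. apply Rle_refl.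
  - apply is_lim_seq_const.
  - replace (Finite 0) with (Rbar_mult K 0) by (simpl; f_equal; ring).
    apply is_lim_seq_scal_l, is_lim_seq_geom. rewrite Rabs_pos_eq; lra.
Qed.

(** A shift changes a symmetric partial sum by two boundary terms, and both tend
to zero. *)
Lemma zsum_shift1 (f : Z -> R) : decays f -> zsum (fun n => f (n + 1)%Z) = zsum f.
Proof.
  intros h.
  assert (h1 := decays_cvg _ (decays_shift f 1 h)).
  apply is_lim_seq_ext with
    (v := fun m => sum_n (pairs f) m + (f (Z.of_nat m + 1)%Z - f (- Z.of_nat m)%Z)) in h1.
  2: intros m; apply sum_pairs_shift.
  assert (h2 : is_lim_seq (fun m => sum_n (pairs f) m + (f (Z.of_nat m + 1)%Z - f (- Z.of_nat m)%Z))
     (zsum f + (0 - 0))).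
  { apply is_lim_seq_plus'; [apply decays_cvg, h|].
    apply is_lim_seq_minus'.
    - apply (decays_tail _ (decays_shift f 1 h)).
    - apply (decays_tail _ (decays_reflect f h)). }
  rewrite (lim_seq_inj _ _ _ h1 h2). ring.
Qed.

Lemma zsum_shift (f : Z -> R) (k : Z) :
  decays f -> zsum (fun n => f (n + k)%Z) = zsum f.
Proof.
  intros h. induction k as [|k IH|k IH] using Z.peano_ind.
  - apply zsum_ext. intros n. f_equal. lia.
  - rewrite <- IH. rewrite <- (zsum_shift1 _ (decays_shift f k h)).
    apply zsum_ext. intros n. f_equal. lia.
  - rewrite <- IH. rewrite <- (zsum_shift1 _ (decays_shift f (Z.pred k) h)).
    apply zsum_ext. intros n. f_equal. lia.
Qed.

(** * Differentiation and products of Fourier series *)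

Lemma zsum_minus (f g : Z -> R) :
  decays f -> decays g -> zsum (fun n => f n - g n) = zsum f - zsum g.
Proof.
  intros hf hg.
  rewrite (zsum_ext _ (fun n => f n + -1 * g n)) by (intros; ring).
  rewrite zsum_plus, zsum_scal by (try apply decays_scal; assumption). ring.
Qed.

Lemma decays_minus (f g : Z -> R) : decays f -> decays g -> decays (fun n => f n - g n).
Proof.
  intros hf hg. apply (decays_ext (fun n => f n + -1 * g n)); [intros; ring|].
  apply decays_plus; [|apply decays_scal]; assumption.
Qed.

Lemma zsum_tail_bound (f : Z -> R) (K eta : R) (hK : 0 <= K) (heta : 0 < eta < 1)
  (hf : forall n, Rabs (f n) <= K * eta ^ Z.abs_nat n) (M : nat) :
  Rabs (zsum f - sum_n (pairs f) M) <= 2 * K * eta ^ S M / (1 - eta).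
Proof.
  assert (hg : decays f) by (exists K, eta; tauto).
  unfold zsum. rewrite (Series_incr_n _ (S M)) by (lia || apply decays_ex_series, hg).
  simpl pred. rewrite <- sum_n_Reals.
  replace (sum_n (pairs f) M + Series (fun k => pairs f (S M + k)) - sum_n (pairs f) M)
    with (Series (fun k => pairs f (S M + k))) by ring.
  assert (hb : forall k, Rabs (pairs f (S M + k)) <= 2 * K * eta ^ S M * eta ^ k).
  { intros k. rewrite Rmult_assoc, <- pow_add. apply pairs_bound; (assumption || lra). }
  assert (he := is_series_geom_scal (2 * K * eta ^ S M) eta heta).
  eapply Rle_trans; [apply Series_Rabs|].
  - apply (@ex_series_le R_AbsRing R_CompleteNormedModule _ (fun n => 2 * K * eta ^ S M * eta ^ n)).
    + intros n. change (Rabs (Rabs (pairs f (S M + n))) <= 2 * K * eta ^ S M * eta ^ n).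
      rewrite Rabs_Rabsolu. apply hb.
    + eexists. exact he.
  - rewrite <- (is_series_unique _ _ he).
    apply Series_le.
    + intros n. split; [apply Rabs_pos|apply hb].
    + eexists. exact he.
Qed.

Lemma first_order_bound (f f' : R -> R)
  (hd : forall x, is_derive f x (f' x))
  (hl : forall x y, Rabs (f' x - f' y) <= Rabs (x - y)) (x h : R) :
  Rabs (f (x + h) - f x - h * f' x) <= h ^ 2.
Proof.
  destruct (MVT_gen f x (x + h) f') as [c [hc e]].
  - intros y _. apply hd.
  - intros y _. apply derivable_continuous_pt. exists (f' y). apply is_derive_Reals, hd.
  - rewrite e. replace (f' c * (x + h - x) - h * f' x) with (h * (f' c - f' x)) by ring.
    rewrite Rabs_mult. rewrite <- (pow2_abs h). simpl. rewrite Rmult_1_r.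
    apply Rmult_le_compat_l; [apply Rabs_pos|].
    eapply Rle_trans; [apply hl|].
    revert hc. unfold Rmin, Rmax, Rabs.
    destruct (Rle_dec x (x + h)), (Rcase_abs (c - x)), (Rcase_abs h); lra.
Qed.

Lemma sin_lipschitz (x y : R) : Rabs (sin x - sin y) <= Rabs (x - y).
Proof.
  destruct (MVT_gen sin y x cos) as [c [_ e]].
  - intros z _. apply is_derive_sin.
  - intros z _. apply continuity_sin.
  - rewrite e, Rabs_mult.
    assert (Rabs (cos c) <= 1) by (apply Rabs_le, COS_bound).
    generalize (Rabs_pos (x - y)). nra.
Qed.

Lemma cos_lipschitz (x y : R) : Rabs (cos x - cos y) <= Rabs (x - y).
Proof.
  rewrite !cos_sin.
  replace (x - y) with (PI / 2 + x - (PI / 2 + y)) by ring. apply sin_lipschitz.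
Qed.

(** The second order remainders add up to at most a constant times [h ^ 2],
because the sequence [n ^ 2 * a n] still decays. This gives the derivative
directly, without uniform convergence of the differentiated series. *)
Lemma zsum_derive (a : Z -> R) (e e' : R -> R)
  (ha : decays a) (he : forall x, Rabs (e x) <= 1) (he' : forall x, Rabs (e' x) <= 1)
  (hT : forall x h, Rabs (e (x + h) - e x - h * e' x) <= h ^ 2) (t : R) :
  is_derive (fun t => zsum (fun n => a n * e (IZR n * t))) t
    (zsum (fun n => IZR n * a n * e' (IZR n * t))).
Proof.
  destruct (decays_index _ (decays_index _ ha)) as [K [eta [hK [heta hb]]]].
  set (B := 2 * K / (1 - eta)).
  assert (hB : 0 <= B).
  { apply Rmult_le_pos; [lra|]. left. apply Rinv_0_lt_compat. lra. }
  assert (key : forall h, Rabs (zsum (fun n => a n * e (IZR n * (t + h)))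
     - zsum (fun n => a n * e (IZR n * t))
     - h * zsum (fun n => IZR n * a n * e' (IZR n * t))) <= h ^ 2 * B).
  { intros h. rewrite <- zsum_scal.
    assert (g1 : forall s, decays (fun n => a n * e (IZR n * s))).
    { intros s. apply (decays_mult_bounded a (fun n => e (IZR n * s))); auto. }
    assert (g2 : decays (fun n => IZR n * a n * e' (IZR n * t))).
    { apply (decays_mult_bounded (fun n => IZR n * a n) (fun n => e' (IZR n * t))); auto.
      apply decays_index, ha. }
    rewrite <- (zsum_minus _ _ (g1 (t + h)) (g1 t)).
    rewrite <- (zsum_minus _ _ (decays_minus _ _ (g1 (t + h)) (g1 t)) (decays_scal h _ g2)).
    replace (h ^ 2 * B) with (2 * (h ^ 2 * K) / (1 - eta)) by (unfold B; field; lra).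
    apply zsum_bound; [apply Rmult_le_pos; [apply pow2_ge_0|lra]|assumption|].
    intros n. specialize (hb n).
    replace (a n * e (IZR n * (t + h)) - a n * e (IZR n * t) - h * (IZR n * a n * e' (IZR n * t)))
      with (a n * (e (IZR n * t + IZR n * h) - e (IZR n * t) - IZR n * h * e' (IZR n * t)))
      by (replace (IZR n * (t + h)) with (IZR n * t + IZR n * h) by ring; ring).
    rewrite Rabs_mult. specialize (hT (IZR n * t) (IZR n * h)).
    apply Rle_trans with (Rabs (a n) * (IZR n * h) ^ 2).
    - apply Rmult_le_compat_l; [apply Rabs_pos|exact hT].
    - rewrite !Rabs_mult in hb.
      replace (Rabs (a n) * (IZR n * h) ^ 2)
        with (h ^ 2 * (Rabs (IZR n) * (Rabs (IZR n) * Rabs (a n)))).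
      + rewrite Rmult_assoc. apply Rmult_le_compat_l; [apply pow2_ge_0|exact hb].
      + rewrite Rpow_mult_distr, <- (pow2_abs (IZR n)). ring. }
  apply is_derive_Reals. intros eps heps.
  assert (hdelta : 0 < eps / (B + 1)) by (apply Rdiv_lt_0_compat; lra).
  exists (mkposreal _ hdelta). intros h hne hh. simpl in hh.
  specialize (key h).
  set (F := fun s => zsum (fun n => a n * e (IZR n * s))) in *.
  set (G := zsum (fun n => IZR n * a n * e' (IZR n * t))) in *.
  change (Rabs (F (t + h) - F t - h * G) <= h ^ 2 * B) in key.
  change (Rabs ((F (t + h) - F t) / h - G) < eps).
  replace ((F (t + h) - F t) / h - G) with ((F (t + h) - F t - h * G) / h) by (field; assumption).
  assert (hp : 0 < Rabs h) by (apply Rabs_pos_lt; assumption).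
  unfold Rdiv. rewrite Rabs_mult, Rabs_inv.
  apply (Rmult_lt_reg_r (Rabs h)); [assumption|].
  rewrite Rmult_assoc, Rinv_l, Rmult_1_r by lra.
  eapply Rle_lt_trans; [exact key|].
  rewrite <- (pow2_abs h).
  assert (Rabs h * (B + 1) < eps).
  { apply (Rmult_lt_compat_r (B + 1)) in hh; [|lra].
    unfold Rdiv in hh. rewrite Rmult_assoc, Rinv_l in hh by lra. lra. }
  nra.
Qed.

(** Here [e j] stands for [cos (j t)] or for [sin (j t)]: the product-to-sum
formula [e_cos] is all that the product of two series needs, so both cases are
treated at once. *)
Section Convolution.
Variables (h b e : Z -> R) (t : R).
Hypothesis h_even : forall k, h (- k)%Z = h k.
Hypothesis h_decays : decays h.
Hypothesis b_decays : decays b.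
Hypothesis e_bound : forall j, Rabs (e j) <= 1.
Hypothesis e_cos : forall j k, e (j + k)%Z + e (j - k)%Z = 2 * cos (IZR k * t) * e j.

(** The product-to-sum formula, followed by shifts of the index. *)
Lemma zsum_times_cos (k : Z) :
  2 * cos (IZR k * t) * zsum (fun j => b j * e j) =
  zsum (fun j => (b (j - k)%Z + b (j + k)%Z) * e j).
Proof.
  assert (g : forall k, decays (fun j => b (j + k)%Z * e j)).
  { intros k'. apply (decays_mult_bounded (fun j => b (j + k')%Z) e e_bound).
    apply decays_shift, b_decays. }
  rewrite (zsum_ext (fun j => (b (j - k)%Z + b (j + k)%Z) * e j)
    (fun j => b (j + - k)%Z * e j + b (j + k)%Z * e j))
    by (intros j; unfold Z.sub; ring).
  rewrite zsum_plus by apply g.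
  rewrite <- (zsum_shift _ k (g (- k)%Z)), <- (zsum_shift _ (- k) (g k)).
  rewrite <- zsum_plus
    by (first [apply (decays_shift _ k (g (- k)%Z)) | apply (decays_shift _ (- k) (g k))]).
  rewrite <- zsum_scal. apply zsum_ext. intros j.
  replace (j + k + - k)%Z with j by lia. replace (j + - k + k)%Z with j by lia.
  change (j + - k)%Z with (j - k)%Z.
  rewrite <- Rmult_plus_distr_l, e_cos. ring.
Qed.

Definition conv_sum (M : nat) (j : Z) : R := sum_n (pairs (fun k => h k * b (j - k)%Z)) M.

Lemma conv_sum_decays (M : nat) : decays (conv_sum M).
Proof.
  induction M as [|M IH].
  - apply (decays_ext (fun j => h 0%Z * b (j + 0)%Z)).
    + intros j. unfold conv_sum. rewrite sum_O. reflexivity.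
    + apply decays_scal, (decays_shift b 0), b_decays.
  - apply (decays_ext (fun j => conv_sum M j +
      (h (Z.of_nat (S M)) * b (j + - Z.of_nat (S M))%Z
       + h (- Z.of_nat (S M))%Z * b (j + - - Z.of_nat (S M))%Z))).
    + intros j. unfold conv_sum. rewrite sum_Sn. reflexivity.
    + apply decays_plus; [exact IH|].
      apply decays_plus; apply decays_scal, decays_shift, b_decays.
Qed.

Lemma zsum_times_cos_sum (M : nat) :
  sum_n (pairs (fun k => h k * cos (IZR k * t))) M * zsum (fun j => b j * e j) =
  zsum (fun j => conv_sum M j * e j).
Proof.
  induction M as [|M IH].
  - rewrite sum_O. simpl pairs. rewrite Rmult_0_l, cos_0, Rmult_1_r, <- zsum_scal.
    apply zsum_ext. intros j. unfold conv_sum. rewrite sum_O. simpl pairs.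
    rewrite Z.sub_0_r. ring.
  - rewrite sum_Sn. unfold plus; simpl AbelianMonoid.plus.
    set (k := Z.of_nat (S M)) in *.
    assert (e1 : pairs (fun k => h k * cos (IZR k * t)) (S M) = h k * (2 * cos (IZR k * t))).
    { unfold pairs. fold k. rewrite h_even, opp_IZR, Ropp_mult_distr_l_reverse, cos_neg. ring. }
    change (@eq R ((sum_n (pairs (fun k => h k * cos (IZR k * t))) M
       + pairs (fun k => h k * cos (IZR k * t)) (S M)) * zsum (fun j => b j * e j))
       (zsum (fun j => conv_sum (S M) j * e j))).
    rewrite e1, Rmult_plus_distr_r, IH, Rmult_assoc, zsum_times_cos, <- zsum_scal.
    rewrite <- zsum_plus.
    + apply zsum_ext. intros j. unfold conv_sum at 2. rewrite sum_Sn.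
      unfold pairs at 2. fold k. fold (conv_sum M j).
      rewrite h_even. replace (j - - k)%Z with (j + k)%Z by lia.
      unfold plus; simpl. ring.
    + apply (decays_mult_bounded _ e e_bound), conv_sum_decays.
    + apply decays_scal, (decays_mult_bounded (fun j => b (j - k)%Z + b (j + k)%Z) e e_bound).
      apply decays_plus; [apply (decays_shift b (- k))|apply decays_shift]; apply b_decays.
Qed.

(** The decay of the two factors is shared between [j] and [k], since
[2 |k| + 2 |j - k| >= |j| + |k|]. The bound is then summable in both indices,
which is what exchanging the limits requires. *)
Lemma conv_term_bound : exists K eta : R, 0 <= K /\ 0 < eta < 1 /\
  forall j k, Rabs (h k * b (j - k)%Z) <= K * eta ^ Z.abs_nat j * eta ^ Z.abs_nat k.
Proof.
  destruct h_decays as [H [r1 [hH [hr1 hh]]]], b_decays as [B [r2 [hB [hr2 hb]]]].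
  set (r := Rmax r1 r2).
  assert (h1 := Rmax_l r1 r2). assert (h2 := Rmax_r r1 r2). fold r in h1, h2.
  assert (hr : 0 < r < 1) by (split; [lra|apply Rmax_lub_lt; lra]).
  destruct (sqrt_unit r hr) as [s0 s1].
  exists (H * B), (sqrt r). repeat split; try assumption; [nra|].
  intros j k. rewrite Rabs_mult.
  assert (a1 : Rabs (h k) <= H * r ^ Z.abs_nat k).
  { eapply Rle_trans; [apply hh|]. apply Rmult_le_compat_l, pow_incr; lra. }
  assert (a2 : Rabs (b (j - k)%Z) <= B * r ^ Z.abs_nat (j - k)).
  { eapply Rle_trans; [apply hb|]. apply Rmult_le_compat_l, pow_incr; lra. }
  apply Rle_trans with ((H * r ^ Z.abs_nat k) * (B * r ^ Z.abs_nat (j - k))).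
  { apply Rmult_le_compat; try apply Rabs_pos; assumption. }
  rewrite !(pow_sqrt r) by lra.
  replace (H * (sqrt r ^ Z.abs_nat k * sqrt r ^ Z.abs_nat k) *
    (B * (sqrt r ^ Z.abs_nat (j - k) * sqrt r ^ Z.abs_nat (j - k))))
    with (H * B * (sqrt r ^ Z.abs_nat k * sqrt r ^ Z.abs_nat k *
      (sqrt r ^ Z.abs_nat (j - k) * sqrt r ^ Z.abs_nat (j - k)))) by ring.
  rewrite (Rmult_assoc (H * B)). rewrite <- !pow_add.
  apply Rmult_le_compat_l; [nra|]. apply pow_le_antitone; [tauto|lia].
Qed.

(** Multiplication by a finite cosine sum is exact. The error of truncating [h]
after [M] is at most a constant times [eta ^ |j| * eta ^ M] in the coefficient
of index [j]; summed over [j], it tends to zero with [M]. *)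
Theorem zsum_conv :
  zsum (fun k => h k * cos (IZR k * t)) * zsum (fun j => b j * e j) =
  zsum (fun j => zsum (fun k => h k * b (j - k)%Z) * e j).
Proof.
  destruct conv_term_bound as [K [eta [hK [heta hb]]]].
  set (s := fun j => zsum (fun k => h k * b (j - k)%Z)).
  assert (hp : forall j : Z, 0 < eta ^ Z.abs_nat j) by (intros; apply pow_lt; lra).
  assert (hi : 0 < / (1 - eta)) by (apply Rinv_0_lt_compat; lra).
  assert (hs : decays s).
  { exists (2 * K / (1 - eta)), eta. repeat split; try tauto.
    - unfold Rdiv. nra.
    - intros j. unfold s.
      replace (2 * K / (1 - eta) * eta ^ Z.abs_nat j)
        with (2 * (K * eta ^ Z.abs_nat j) / (1 - eta)) by (field; lra).
      apply zsum_bound; [|assumption|apply hb].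
      specialize (hp j). nra. }
  assert (hd : forall M, Rabs (zsum (fun j => s j * e j) - zsum (fun j => conv_sum M j * e j))
    <= 2 * (2 * K / (1 - eta)) / (1 - eta) * eta ^ S M).
  { intros M. rewrite <- zsum_minus.
    2,3: apply (decays_mult_bounded _ e e_bound); [exact hs || apply conv_sum_decays].
    replace (2 * (2 * K / (1 - eta)) / (1 - eta) * eta ^ S M)
      with (2 * (2 * K / (1 - eta) * eta ^ S M) / (1 - eta)) by (field; lra).
    assert (0 < eta ^ S M) by (apply pow_lt; lra).
    apply zsum_bound; [unfold Rdiv; apply Rmult_le_pos; nra|assumption|].
    intros j. rewrite <- Rmult_minus_distr_r, Rabs_mult.
    apply Rle_trans with (Rabs (s j - conv_sum M j)).
    - generalize (Rabs_pos (s j - conv_sum M j)), (e_bound j). nra.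
    - replace (2 * K / (1 - eta) * eta ^ S M * eta ^ Z.abs_nat j)
        with (2 * (K * eta ^ Z.abs_nat j) * eta ^ S M / (1 - eta)) by (field; lra).
      apply zsum_tail_bound; [|assumption|apply hb].
      specialize (hp j). nra. }
  assert (l0 : is_lim_seq (fun M => zsum (fun j => s j * e j) - zsum (fun j => conv_sum M j * e j)) 0).
  { apply is_lim_seq_abs_0.
    apply is_lim_seq_le_le with (u := fun _ => 0)
      (w := fun M => 2 * (2 * K / (1 - eta)) / (1 - eta) * eta ^ S M).
    - intros M. split; [apply Rabs_pos|apply hd].
    - apply is_lim_seq_const.
    - replace (Finite 0) with (Rbar_mult (2 * (2 * K / (1 - eta)) / (1 - eta)) 0)
        by (simpl; f_equal; ring).
      apply is_lim_seq_scal_l.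
      apply (is_lim_seq_incr_1 (fun M => eta ^ M)), is_lim_seq_geom.
      rewrite Rabs_pos_eq; lra. }
  assert (l1 : is_lim_seq (fun M => zsum (fun j => s j * e j) - zsum (fun j => conv_sum M j * e j))
    (zsum (fun j => s j * e j) -
     zsum (fun k => h k * cos (IZR k * t)) * zsum (fun j => b j * e j))).
  { apply is_lim_seq_minus'; [apply is_lim_seq_const|].
    apply is_lim_seq_ext with
      (u := fun M => sum_n (pairs (fun k => h k * cos (IZR k * t))) M * zsum (fun j => b j * e j)).
    - intros M. apply zsum_times_cos_sum.
    - apply is_lim_seq_mult'; [|apply is_lim_seq_const].
      apply decays_cvg. apply (decays_mult_bounded h (fun k => cos (IZR k * t))); [|assumption].
      intros k. apply Rabs_le, COS_bound. }
  generalize (lim_seq_inj _ _ _ l0 l1). unfold s. lra.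
Qed.

End Convolution.

(** * Hyperbolic coefficients and their telescoping convolutions *)

Lemma cosh_pos (x : R) : 0 < cosh x.
Proof. unfold cosh. generalize (exp_pos x), (exp_pos (- x)). lra. Qed.

Lemma cosh_opp (x : R) : cosh (- x) = cosh x.
Proof. unfold cosh. rewrite Ropp_involutive. lra. Qed.

Lemma sinh_opp (x : R) : sinh (- x) = - sinh x.
Proof. unfold sinh. rewrite Ropp_involutive. lra. Qed.

Lemma cosh_plus (x y : R) : cosh (x + y) = cosh x * cosh y + sinh x * sinh y.
Proof. unfold cosh, sinh. rewrite Ropp_plus_distr, !exp_plus. field. Qed.

Lemma sinh_plus (x y : R) : sinh (x + y) = sinh x * cosh y + cosh x * sinh y.
Proof. unfold cosh, sinh. rewrite Ropp_plus_distr, !exp_plus. field. Qed.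

Lemma sinh_neq_0 (x : R) : x <> 0 -> sinh x <> 0.
Proof.
  intros h. destruct (Rtotal_order x 0) as [l|[l|l]].
  - apply sinh_lt in l. rewrite sinh_0 in l. lra.
  - contradiction.
  - apply sinh_lt in l. rewrite sinh_0 in l. lra.
Qed.

Definition odd_part (f : Z -> R) (k : Z) : R := if Z.odd k then f k else 0.
(** Ending at an odd index keeps the boundary terms of the telescoping sums in
the parity class of the summation indices. *)
Definition odd_sum (f : Z -> R) (m : nat) : R := sum_n (pairs (odd_part f)) (2 * m + 1).

Lemma odd_of_nat_odd (m : nat) : Z.odd (Z.of_nat (2 * m + 1)) = true.
Proof.
  replace (Z.of_nat (2 * m + 1)) with (1 + 2 * Z.of_nat m)%Z by lia.
  rewrite Z.odd_add_mul_2. reflexivity.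
Qed.

Lemma odd_of_nat_even (m : nat) : Z.odd (Z.of_nat (2 * m + 2)) = false.
Proof.
  replace (Z.of_nat (2 * m + 2)) with (0 + 2 * Z.of_nat (m + 1))%Z by lia.
  rewrite Z.odd_add_mul_2. reflexivity.
Qed.

Lemma odd_sum_0 (f : Z -> R) : odd_sum f 0 = f 1%Z + f (-1)%Z.
Proof.
  unfold odd_sum. simpl Nat.add. rewrite sum_Sn, sum_O. unfold plus; simpl.
  unfold odd_part; simpl. ring.
Qed.

Lemma odd_sum_S (f : Z -> R) (m : nat) :
  odd_sum f (S m) =
  odd_sum f m + (f (Z.of_nat (2 * m + 1) + 2)%Z + f (- (Z.of_nat (2 * m + 1) + 2))%Z).
Proof.
  unfold odd_sum. replace (2 * S m + 1)%nat with (S (S (2 * m + 1))) by lia.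
  rewrite !sum_Sn.
  assert (e1 : pairs (odd_part f) (S (2 * m + 1)) = 0).
  { unfold pairs, odd_part. rewrite Z.odd_opp.
    replace (S (2 * m + 1)) with (2 * m + 2)%nat by lia. rewrite odd_of_nat_even. ring. }
  assert (e2 : pairs (odd_part f) (S (S (2 * m + 1))) =
    f (Z.of_nat (2 * m + 1) + 2)%Z + f (- (Z.of_nat (2 * m + 1) + 2))%Z).
  { unfold pairs, odd_part. rewrite Z.odd_opp.
    replace (S (S (2 * m + 1))) with (2 * S m + 1)%nat by lia. rewrite odd_of_nat_odd.
    replace (Z.of_nat (2 * S m + 1)) with (Z.of_nat (2 * m + 1) + 2)%Z by lia. ring. }
  rewrite e1, e2. unfold plus; simpl. ring.
Qed.

Lemma odd_sum_cvg (f : Z -> R) :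
  decays (odd_part f) -> is_lim_seq (odd_sum f) (zsum (odd_part f)).
Proof.
  intros h. apply (is_lim_seq_subseq (sum_n (pairs (odd_part f))) _ (fun m => 2 * m + 1)%nat).
  - apply eventually_subseq. intros n. lia.
  - apply decays_cvg, h.
Qed.

Section Elliptic.
Variable lam : R.
Hypothesis lam_pos : 0 < lam.

Notation ch k := (cosh (lam * IZR k)).
Notation sh k := (sinh (lam * IZR k)).

(** Up to normalisation, the Fourier coefficients of the elliptic function cn. *)
Definition cn_coef (k : Z) : R := if Z.odd k then / ch k else 0.
Definition dn_coef (j : Z) : R := if Z.odd j then 0 else / ch j.
(** Even indices carry the cosine coefficients of dn, odd indices the sine
coefficients of sn. Kept in one sequence, they satisfy a single convolution
identity. *)
Definition theta_coef (j : Z) : R := if Z.odd j then / sh j else / ch j.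
(** The partial fractions of products of two coefficients: coth at odd and tanh
at even indices. In both cases the function is odd with limits [1] and [- 1],
the only facts that the telescoping uses. *)
Definition kernel (j : Z) : R := if Z.odd j then ch j / sh j else sh j / ch j.

Lemma ch_neq_0 (k : Z) : ch k <> 0.
Proof. apply Rgt_not_eq, cosh_pos. Qed.

Lemma sh_neq_0 (k : Z) : Z.odd k = true -> sh k <> 0.
Proof.
  intros h. apply sinh_neq_0. apply Rmult_integral_contrapositive. split; [lra|].
  apply not_0_IZR. intros e. rewrite e in h. discriminate.
Qed.

Lemma ch_opp (k : Z) : ch (- k) = ch k.
Proof. rewrite opp_IZR, Ropp_mult_distr_r_reverse. apply cosh_opp. Qed.

Lemma sh_opp (k : Z) : sh (- k) = - sh k.
Proof. rewrite opp_IZR, Ropp_mult_distr_r_reverse. apply sinh_opp. Qed.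

Lemma cn_coef_opp (k : Z) : cn_coef (- k) = cn_coef k.
Proof. unfold cn_coef. rewrite Z.odd_opp, ch_opp. reflexivity. Qed.

Lemma theta_coef_opp (k : Z) :
  theta_coef (- k) = if Z.odd k then - theta_coef k else theta_coef k.
Proof.
  unfold theta_coef. rewrite Z.odd_opp, ch_opp, sh_opp.
  generalize (sh_neq_0 k). destruct (Z.odd k); intros h; [|reflexivity].
  field. auto.
Qed.

Lemma kernel_opp (k : Z) : kernel (- k) = - kernel k.
Proof.
  unfold kernel. rewrite Z.odd_opp, ch_opp, sh_opp.
  generalize (sh_neq_0 k), (ch_neq_0 k). destruct (Z.odd k); intros h h'; field; auto.
Qed.

(** The addition formula for [lam j = lam k + lam (j - k)]: for cosh when [j] is
even, for sinh when [j] is odd. *)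
Lemma cn_theta_split (j k : Z) : Z.odd k = true ->
  cn_coef k * theta_coef (j - k) = theta_coef j * (sh k / ch k + kernel (j - k)).
Proof.
  intros hk. unfold cn_coef, theta_coef, kernel. rewrite Z.odd_sub, hk.
  assert (e : lam * IZR j = lam * IZR k + lam * IZR (j - k)) by (rewrite minus_IZR; ring).
  generalize (sh_neq_0 j), (sh_neq_0 (j - k)), (ch_neq_0 k), (ch_neq_0 (j - k)), (ch_neq_0 j).
  rewrite Z.odd_sub, hk, e, cosh_plus, sinh_plus.
  destruct (Z.odd j); simpl; intros h1 h2 h3 h4 h5.
  - specialize (h1 eq_refl). field. auto.
  - specialize (h2 eq_refl). field. auto.
Qed.

Lemma theta_dn_split (j k : Z) : Z.odd k = true -> Z.odd j = true ->
  theta_coef k * dn_coef (j - k) = cn_coef j * (kernel k + kernel (j - k)).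
Proof.
  intros hk hj. unfold cn_coef, theta_coef, dn_coef, kernel. rewrite Z.odd_sub, hk, hj. simpl.
  assert (e : lam * IZR j = lam * IZR k + lam * IZR (j - k)) by (rewrite minus_IZR; ring).
  generalize (sh_neq_0 k hk), (ch_neq_0 (j - k)), (ch_neq_0 j).
  rewrite e, cosh_plus. intros h1 h2 h3. field. auto.
Qed.

Lemma exp_pow (n : nat) : exp (- lam) ^ n = exp (- (lam * INR n)).
Proof.
  induction n as [|n IH].
  - simpl. rewrite Rmult_0_r, Ropp_0, exp_0. reflexivity.
  - rewrite <- tech_pow_Rmult, IH, <- exp_plus, S_INR. f_equal. ring.
Qed.

Lemma exp_lam_unit : 0 < exp (- lam) < 1.
Proof.
  split; [apply exp_pos|]. rewrite <- exp_0. apply exp_increasing. lra.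
Qed.

Lemma inv_ch_bound (k : Z) : / ch k <= 2 * exp (- lam) ^ Z.abs_nat k.
Proof.
  rewrite exp_pow, <- Rabs_IZR_abs_nat.
  assert (e : ch k = cosh (lam * Rabs (IZR k))).
  { unfold Rabs. destruct (Rcase_abs (IZR k)); [|reflexivity].
    rewrite Ropp_mult_distr_r_reverse, cosh_opp. reflexivity. }
  rewrite e. set (x := lam * Rabs (IZR k)).
  apply (Rmult_le_reg_l (cosh x)); [apply cosh_pos|].
  rewrite Rinv_r by (apply Rgt_not_eq, cosh_pos).
  unfold cosh. assert (hx : exp x * exp (- x) = 1).
  { rewrite <- exp_plus, Rplus_opp_r. apply exp_0. }
  generalize (exp_pos x), (exp_pos (- x)). nra.
Qed.

Lemma inv_sh_bound (k : Z) : Z.odd k = true ->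
  Rabs (/ sh k) <= 2 / (1 - exp (- lam)) * exp (- lam) ^ Z.abs_nat k.
Proof.
  intros hk.
  assert (hx : lam <= lam * Rabs (IZR k)).
  { rewrite <- (Rmult_1_r lam) at 1. apply Rmult_le_compat_l; [lra|].
    rewrite <- abs_IZR. apply IZR_le. destruct k; try discriminate; simpl; lia. }
  rewrite exp_pow, <- Rabs_IZR_abs_nat.
  assert (e : Rabs (sh k) = sinh (lam * Rabs (IZR k))).
  { assert (p : 0 < sinh (lam * Rabs (IZR k))).
    { rewrite <- sinh_0. apply sinh_lt. lra. }
    rewrite <- (Rabs_pos_eq (sinh (lam * Rabs (IZR k)))) by lra.
    unfold Rabs at 3. destruct (Rcase_abs (IZR k)); [|reflexivity].
    rewrite Ropp_mult_distr_r_reverse, sinh_opp, Rabs_Ropp. reflexivity. }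
  rewrite Rabs_inv, e. set (x := lam * Rabs (IZR k)) in *.
  assert (p : 0 < sinh x) by (rewrite <- sinh_0; apply sinh_lt; lra).
  destruct exp_lam_unit as [u0 u1].
  assert (hl : exp (- x) <= exp (- lam)).
  { destruct hx as [hx|hx]; [left; apply exp_increasing; lra|rewrite <- hx; lra]. }
  assert (h1 : exp x * exp (- x) = 1).
  { rewrite <- exp_plus, Rplus_opp_r. apply exp_0. }
  assert (0 < exp x) by apply exp_pos. assert (0 < exp (- x)) by apply exp_pos.
  apply (Rmult_le_reg_l (sinh x)); [assumption|]. rewrite Rinv_r by lra.
  apply (Rmult_le_reg_l (1 - exp (- lam))); [lra|].
  replace ((1 - exp (- lam)) * (sinh x * (2 / (1 - exp (- lam)) * exp (- x))))
    with (2 * sinh x * exp (- x)) by (field; lra).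
  unfold sinh. nra.
Qed.

Lemma decays_theta : decays theta_coef.
Proof.
  destruct exp_lam_unit as [u0 u1].
  assert (1 < / (1 - exp (- lam))).
  { rewrite <- Rinv_1 at 1. apply Rinv_lt_contravar; lra. }
  exists (2 / (1 - exp (- lam))), (exp (- lam)). unfold Rdiv.
  repeat split; try tauto; [lra|].
  intros n. unfold theta_coef. generalize (inv_sh_bound n).
  destruct (Z.odd n); intros hs; [apply hs; reflexivity|].
  rewrite Rabs_pos_eq by (left; apply Rinv_0_lt_compat, cosh_pos).
  eapply Rle_trans; [apply inv_ch_bound|].
  apply Rmult_le_compat_r; [apply pow_le|]; lra.
Qed.

Lemma decays_cn : decays cn_coef.
Proof.
  exists 2, (exp (- lam)). split; [lra|]. split; [apply exp_lam_unit|].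
  intros n. unfold cn_coef. destruct (Z.odd n).
  - rewrite Rabs_pos_eq by (left; apply Rinv_0_lt_compat, cosh_pos). apply inv_ch_bound.
  - rewrite Rabs_R0. apply Rmult_le_pos; [lra|]. apply pow_le, Rlt_le, exp_pos.
Qed.

Lemma decays_dn : decays dn_coef.
Proof.
  apply (decays_le theta_coef); [|apply decays_theta].
  intros n. unfold dn_coef, theta_coef. destruct (Z.odd n); [|lra].
  rewrite Rabs_R0. apply Rabs_pos.
Qed.

Lemma kernel_minus_1_bound (n : nat) :
  Rabs (kernel (Z.of_nat n) - 1) <= 4 / (1 - exp (- lam)) * exp (- lam) ^ n.
Proof.
  destruct exp_lam_unit as [u0 u1].
  assert (hi : 1 < / (1 - exp (- lam))).
  { rewrite <- Rinv_1 at 1. apply Rinv_lt_contravar; lra. }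
  generalize (inv_sh_bound (Z.of_nat n)), (inv_ch_bound (Z.of_nat n)), (sh_neq_0 (Z.of_nat n)),
    (ch_neq_0 (Z.of_nat n)).
  unfold kernel. rewrite Zabs2Nat.id.
  set (x := lam * IZR (Z.of_nat n)).
  assert (hx : exp (- x) <= 1).
  { rewrite <- exp_0. unfold x. rewrite <- INR_IZR_INZ. 
    assert (0 <= lam * INR n) by (apply Rmult_le_pos; [lra|apply pos_INR]).
    destruct H as [H|H]; [left; apply exp_increasing; lra|rewrite <- H, Ropp_0; lra]. }
  assert (0 < exp (- x)) by apply exp_pos.
  assert (hd : cosh x - sinh x = exp (- x)) by (unfold cosh, sinh; field).
  assert (hp : 0 < exp (- lam) ^ n) by (apply pow_lt; lra).
  destruct (Z.odd (Z.of_nat n)); intros b1 b2 n1 n2.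
  - specialize (b1 eq_refl). specialize (n1 eq_refl).
    replace (cosh x / sinh x - 1) with ((cosh x - sinh x) * / sinh x) by (field; assumption).
    rewrite hd, Rabs_mult, (Rabs_pos_eq (exp _)) by lra.
    generalize (Rabs_pos (/ sinh x)). intros. unfold Rdiv in *. nra.
  - replace (sinh x / cosh x - 1) with (- ((cosh x - sinh x) * / cosh x)) by (field; assumption).
    assert (0 < / cosh x) by (apply Rinv_0_lt_compat, cosh_pos).
    rewrite hd, Rabs_Ropp, Rabs_pos_eq by nra. unfold Rdiv. nra.
Qed.

Lemma kernel_lim (j : Z) : is_lim_seq (fun n => kernel (j + Z.of_nat n)) 1.
Proof.
  induction j as [|j IH|j IH] using Z.peano_ind.
  - destruct exp_lam_unit as [u0 u1].
    apply (is_lim_seq_ext (fun n => (kernel (Z.of_nat n) - 1) + 1)).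
    { intros n. rewrite Z.add_0_l. ring. }
    replace (Finite 1) with (Finite (0 + 1)) by (f_equal; ring).
    apply is_lim_seq_plus'; [|apply is_lim_seq_const].
    apply is_lim_seq_abs_0.
    apply is_lim_seq_le_le with (u := fun _ => 0)
      (w := fun n => 4 / (1 - exp (- lam)) * exp (- lam) ^ n).
    + intros n. split; [apply Rabs_pos|apply kernel_minus_1_bound].
    + apply is_lim_seq_const.
    + replace (Finite 0) with (Rbar_mult (4 / (1 - exp (- lam))) 0)
        by (simpl; f_equal; ring).
      apply is_lim_seq_scal_l, is_lim_seq_geom. rewrite Rabs_pos_eq; lra.
  - apply (is_lim_seq_ext (fun n => kernel (j + Z.of_nat (S n)))).
    + intros n. f_equal. lia.
    + apply (is_lim_seq_incr_1 (fun n => kernel (j + Z.of_nat n))), IH.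
  - apply is_lim_seq_incr_1.
    apply (is_lim_seq_ext (fun n => kernel (j + Z.of_nat n))); [|exact IH].
    intros n. f_equal. lia.
Qed.

Lemma kernel_lim_right (j : Z) : is_lim_seq (fun m => kernel (j + Z.of_nat (2 * m + 1))) 1.
Proof.
  apply (is_lim_seq_subseq (fun n => kernel (j + Z.of_nat n)) _ (fun m => 2 * m + 1)%nat).
  - apply eventually_subseq. intros n. lia.
  - apply kernel_lim.
Qed.

Lemma kernel_lim_left (j : Z) : is_lim_seq (fun m => kernel (j - Z.of_nat (2 * m + 1))) (- (1)).
Proof.
  apply (is_lim_seq_ext (fun m => - kernel (- j + Z.of_nat (2 * m + 1)))).
  - intros m. rewrite <- kernel_opp. f_equal. lia.
  - apply (proj1 (is_lim_seq_opp _ (Finite 1))), kernel_lim_right.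
Qed.

(** Increasing [j] by [2] slides the window of summation by one place, so only
the two ends change. *)
Lemma kernel_sum_step (j : Z) (m : nat) :
  odd_sum (fun k => kernel (j + 2 - k)) m =
  odd_sum (fun k => kernel (j - k)) m +
  (kernel (j + 2 + Z.of_nat (2 * m + 1)) - kernel (j - Z.of_nat (2 * m + 1))).
Proof.
  induction m as [|m IH].
  - rewrite !odd_sum_0. change (Z.of_nat (2 * 0 + 1)) with 1%Z.
    replace (j - -1)%Z with (j + 2 - 1)%Z by lia.
    replace (j + 2 - -1)%Z with (j + 2 + 1)%Z by lia. ring.
  - rewrite !odd_sum_S, IH.
    replace (Z.of_nat (2 * S m + 1)) with (Z.of_nat (2 * m + 1) + 2)%Z by lia.
    set (M := Z.of_nat (2 * m + 1)).
    replace (j + 2 - (M + 2))%Z with (j - M)%Z by lia.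
    replace (j + 2 - - (M + 2))%Z with (j + 2 + (M + 2))%Z by lia.
    replace (j - - (M + 2))%Z with (j + 2 + M)%Z by lia. ring.
Qed.

Lemma kernel_sum_diff_lim (j : Z) :
  is_lim_seq (fun m => kernel (j + 2 + Z.of_nat (2 * m + 1)) - kernel (j - Z.of_nat (2 * m + 1))) 2.
Proof.
  replace (Finite 2) with (Finite (1 - - (1))) by (f_equal; ring).
  apply is_lim_seq_minus'; [apply kernel_lim_right|apply kernel_lim_left].
Qed.

Lemma kernel_sum_0 (m : nat) : odd_sum (fun k => kernel (0 - k)) m = 0.
Proof.
  induction m as [|m IH].
  - rewrite odd_sum_0. replace (0 - -1)%Z with (- (0 - 1))%Z by lia. rewrite (kernel_opp (0 - 1)). ring.
  - rewrite odd_sum_S, IH. set (M := (Z.of_nat (2 * m + 1) + 2)%Z).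
    replace (0 - - M)%Z with (- (0 - M))%Z by lia. rewrite (kernel_opp (0 - M)). ring.
Qed.

Lemma kernel_at_0 : kernel 0 = 0.
Proof. unfold kernel. simpl. rewrite Rmult_0_r, sinh_0. unfold Rdiv. ring. Qed.

Lemma kernel_sum_1 (m : nat) :
  odd_sum (fun k => kernel (1 - k)) m = kernel (1 + Z.of_nat (2 * m + 1)).
Proof.
  induction m as [|m IH].
  - rewrite odd_sum_0. simpl. rewrite kernel_at_0. ring.
  - rewrite odd_sum_S, IH.
    replace (Z.of_nat (2 * S m + 1)) with (Z.of_nat (2 * m + 1) + 2)%Z by lia.
    set (M := Z.of_nat (2 * m + 1)).
    replace (1 - (M + 2))%Z with (- (1 + M))%Z by lia. rewrite kernel_opp.
    replace (1 - - (M + 2))%Z with (1 + (M + 2))%Z by lia. ring.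
Qed.

(** Each step of [2] in [j] adds the total variation [1 - (- 1) = 2] of the
kernel; at [j = 0] and [j = 1] the sum is known because the kernel is odd. *)
Lemma kernel_sum_lim (j : Z) :
  is_lim_seq (odd_sum (fun k => kernel (j - k))) (IZR j).
Proof.
  assert (base : forall b, b = 0%Z \/ b = 1%Z ->
    is_lim_seq (odd_sum (fun k => kernel (b - k))) (IZR b)).
  { intros b [->| ->].
    - apply (is_lim_seq_ext (fun _ => 0)); [|apply is_lim_seq_const].
      intros m. symmetry. apply kernel_sum_0.
    - apply (is_lim_seq_ext (fun m => kernel (1 + Z.of_nat (2 * m + 1)))); [|apply kernel_lim_right].
      intros m. symmetry. apply kernel_sum_1. }
  assert (all : forall b, b = 0%Z \/ b = 1%Z -> forall i,
    is_lim_seq (odd_sum (fun k => kernel (b + 2 * i - k))) (IZR (b + 2 * i))).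
  { intros b hb i. induction i as [|i IH|i IH] using Z.peano_ind.
    - rewrite Z.mul_0_r, Z.add_0_r. apply base, hb.
    - replace (b + 2 * Z.succ i)%Z with (b + 2 * i + 2)%Z by lia.
      rewrite plus_IZR.
      eapply is_lim_seq_ext; [intros m; symmetry; apply kernel_sum_step|].
      apply is_lim_seq_plus'; [exact IH|apply kernel_sum_diff_lim].
    - set (j' := (b + 2 * Z.pred i)%Z).
      replace (b + 2 * i)%Z with (j' + 2)%Z in IH by (unfold j'; lia).
      replace (IZR j') with (IZR (j' + 2) - 2) by (rewrite plus_IZR; ring).
      apply (is_lim_seq_ext (fun m => odd_sum (fun k => kernel (j' + 2 - k)) m -
        (kernel (j' + 2 + Z.of_nat (2 * m + 1)) - kernel (j' - Z.of_nat (2 * m + 1))))).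
      + intros m. rewrite kernel_sum_step. ring.
      + apply is_lim_seq_minus'; [exact IH|apply kernel_sum_diff_lim]. }
  specialize (all (if Z.odd j then 1 else 0)%Z).
  rewrite (Zdiv2_odd_eqn j), Z.add_comm. apply all. destruct (Z.odd j); auto.
Qed.

Lemma odd_sum_ext (f g : Z -> R) (m : nat) :
  (forall k, Z.odd k = true -> f k = g k) -> odd_sum f m = odd_sum g m.
Proof.
  intros h. apply sum_n_ext. intros n. apply pairs_ext. intros k.
  unfold odd_part. generalize (h k). destruct (Z.odd k); auto.
Qed.

Lemma odd_sum_plus (f g : Z -> R) (m : nat) :
  odd_sum (fun k => f k + g k) m = odd_sum f m + odd_sum g m.
Proof.
  induction m as [|m IH]; [rewrite !odd_sum_0|rewrite !odd_sum_S, IH]; ring.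
Qed.

Lemma odd_sum_scal (a : R) (f : Z -> R) (m : nat) :
  odd_sum (fun k => a * f k) m = a * odd_sum f m.
Proof.
  induction m as [|m IH]; [rewrite !odd_sum_0|rewrite !odd_sum_S, IH]; ring.
Qed.

Lemma odd_sum_odd (f : Z -> R) (m : nat) :
  (forall k, f (- k)%Z = - f k) -> odd_sum f m = 0.
Proof.
  intros h. induction m as [|m IH].
  - rewrite odd_sum_0. change (-1)%Z with (- (1))%Z. rewrite h. ring.
  - rewrite odd_sum_S, IH, h. ring.
Qed.

Lemma decays_conv (h b : Z -> R) (j : Z) : decays h -> decays b -> decays (fun k => h k * b (j - k)%Z).
Proof.
  intros hh hb. destruct (conv_term_bound h b hh hb) as [K [eta [hK [heta hc]]]].
  exists (K * eta ^ Z.abs_nat j), eta. repeat split; try tauto.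
  - apply Rmult_le_pos; [assumption|]. apply pow_le; lra.
  - apply hc.
Qed.

Lemma zsum_unique_odd (f g : Z -> R) (l : R) :
  decays f -> (forall k, Z.odd k = false -> f k = 0) ->
  (forall k, Z.odd k = true -> f k = g k) ->
  is_lim_seq (odd_sum g) l -> zsum f = l.
Proof.
  intros hf h0 h1 hl.
  assert (e : forall k, f k = odd_part f k).
  { intros k. unfold odd_part. generalize (h0 k). destruct (Z.odd k); auto. }
  assert (hc := odd_sum_cvg f (decays_ext _ _ e hf)).
  rewrite <- (zsum_ext _ _ e) in hc.
  apply (is_lim_seq_ext _ (odd_sum g)) in hc.
  - exact (lim_seq_inj _ _ _ hc hl).
  - intros m. apply odd_sum_ext, h1.
Qed.

(** The tanh terms cancel in pairs and the kernel terms sum to [j]. The factor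
[j] on the right is a differentiation: this is [S' = C D] and [D' = - C S] at
the level of coefficients. *)
Lemma cn_theta_conv (j : Z) :
  zsum (fun k => cn_coef k * theta_coef (j - k)) = IZR j * theta_coef j.
Proof.
  apply zsum_unique_odd with
    (g := fun k => theta_coef j * (sh k / ch k + kernel (j - k))).
  - apply decays_conv; [apply decays_cn|apply decays_theta].
  - intros k hk. unfold cn_coef. rewrite hk. ring.
  - intros k hk. apply cn_theta_split, hk.
  - apply (is_lim_seq_ext (fun m => odd_sum (fun k => kernel (j - k)) m * theta_coef j)).
    + intros m. rewrite odd_sum_scal, odd_sum_plus.
      rewrite (odd_sum_odd (fun k => sh k / ch k)).
      * ring.
      * intros k. rewrite sh_opp, ch_opp. unfold Rdiv. ring.
    + apply is_lim_seq_mult'; [apply kernel_sum_lim|apply is_lim_seq_const].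
Qed.

(** The factor that turns [sin (k t)] into a cosine when [t] moves by a quarter
period. *)
Definition quarter_sign (k : Z) : R := sin (IZR k * (PI / 2)).

Lemma quarter_sign_opp (k : Z) : quarter_sign (- k) = - quarter_sign k.
Proof. unfold quarter_sign. rewrite opp_IZR, Ropp_mult_distr_l_reverse. apply sin_neg. Qed.

Lemma quarter_sign_add_2 (k : Z) : quarter_sign (k + 2) = - quarter_sign k.
Proof.
  unfold quarter_sign. rewrite plus_IZR, <- neg_sin. f_equal. field.
Qed.

Lemma quarter_sign_1 : quarter_sign 1 = 1.
Proof. unfold quarter_sign. rewrite Rmult_1_l. apply sin_PI2. Qed.

Lemma quarter_sign_bound (k : Z) : Rabs (quarter_sign k) <= 1.
Proof. apply Rabs_le, SIN_bound. Qed.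

Lemma sin_IZR_PI (i : Z) : sin (IZR i * PI) = 0.
Proof. apply sin_eq_0_1. exists i. reflexivity. Qed.

Lemma cos_odd_PI2 (k : Z) : Z.odd k = true -> cos (IZR k * (PI / 2)) = 0.
Proof.
  intros hk. rewrite (Zdiv2_odd_eqn k), hk, plus_IZR, mult_IZR.
  replace ((2 * IZR (Z.div2 k) + 1) * (PI / 2)) with (PI / 2 + IZR (Z.div2 k) * PI) by field.
  rewrite cos_plus, sin_IZR_PI, cos_PI2. ring.
Qed.

Lemma quarter_sign_even (k : Z) : Z.odd k = false -> quarter_sign k = 0.
Proof.
  intros h. unfold quarter_sign. rewrite (Zdiv2_odd_eqn k), h, Z.add_0_r, mult_IZR.
  replace (2 * IZR (Z.div2 k) * (PI / 2)) with (IZR (Z.div2 k) * PI) by field.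
  apply sin_IZR_PI.
Qed.

Definition alt_sum (j : Z) (m : nat) : R := odd_sum (fun k => quarter_sign k * kernel (j - k)) m.

(** The signs alternate, so here it is the sum of two neighbours, instead of
their difference, that reduces to its boundary terms. *)
Lemma alt_sum_step (j : Z) (m : nat) :
  alt_sum (j + 2) m + alt_sum j m =
  quarter_sign (Z.of_nat (2 * m + 1)) *
  (kernel (j - Z.of_nat (2 * m + 1)) - kernel (j + 2 + Z.of_nat (2 * m + 1))).
Proof.
  unfold alt_sum. induction m as [|m IH].
  - rewrite !odd_sum_0. change (Z.of_nat (2 * 0 + 1)) with 1%Z. change (-1)%Z with (- (1))%Z.
    rewrite quarter_sign_opp, quarter_sign_1.
    replace (j - - (1))%Z with (j + 2 - 1)%Z by lia.
    replace (j + 2 - - (1))%Z with (j + 2 + 1)%Z by lia. ring.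
  - rewrite !odd_sum_S.
    replace (Z.of_nat (2 * S m + 1)) with (Z.of_nat (2 * m + 1) + 2)%Z by lia.
    set (M := Z.of_nat (2 * m + 1)) in *.
    rewrite quarter_sign_opp, quarter_sign_add_2.
    replace (j + 2 - (M + 2))%Z with (j - M)%Z by lia.
    replace (j + 2 - - (M + 2))%Z with (j + 2 + (M + 2))%Z by lia.
    replace (j - - (M + 2))%Z with (j + 2 + M)%Z by lia.
    apply (Rplus_eq_compat_r (- quarter_sign M * (kernel (j - M) + kernel (j - (M + 2)))
      - - quarter_sign M * (kernel (j + 2 + (M + 2)) + kernel (j + 2 + M)))) in IH.
    (* Regroup the goal so that the induction hypothesis applies to its first part. *)
    transitivity (odd_sum (fun k => quarter_sign k * kernel (j + 2 - k)) m +
      odd_sum (fun k => quarter_sign k * kernel (j - k)) m +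
      (- quarter_sign M * (kernel (j - M) + kernel (j - (M + 2))) -
      - quarter_sign M * (kernel (j + 2 + (M + 2)) + kernel (j + 2 + M)))); [ring|].
    rewrite IH. ring.
Qed.

Lemma bounded_mult_lim_0 (s u : nat -> R) :
  (forall n, Rabs (s n) <= 1) -> is_lim_seq u 0 -> is_lim_seq (fun n => s n * u n) 0.
Proof.
  intros hs hu. apply is_lim_seq_abs_0.
  apply is_lim_seq_le_le with (u := fun _ => 0) (w := fun n => Rabs (u n)).
  - intros n. split; [apply Rabs_pos|]. rewrite Rabs_mult.
    generalize (hs n), (Rabs_pos (u n)). nra.
  - apply is_lim_seq_const.
  - apply (proj1 (is_lim_seq_abs_0 u)), hu.
Qed.

(** The alternating sums oscillate with the sign of their last term; adding that
sign produces a sequence that converges. *)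
Definition alt_rest (j : Z) (m : nat) : R :=
  alt_sum j m + quarter_sign (Z.of_nat (2 * m + 1)).

Lemma alt_rest_step_lim (j : Z) :
  is_lim_seq (fun m => alt_rest (j + 2) m + alt_rest j m) 0.
Proof.
  apply (is_lim_seq_ext (fun m => quarter_sign (Z.of_nat (2 * m + 1)) *
    (2 - (kernel (j + 2 + Z.of_nat (2 * m + 1)) - kernel (j - Z.of_nat (2 * m + 1)))))).
  - intros m. unfold alt_rest. generalize (alt_sum_step j m). intros h.
    apply (Rplus_eq_reg_r (- (alt_sum (j + 2) m + alt_sum j m))). rewrite h at 1. ring.
  - apply bounded_mult_lim_0; [intros; apply quarter_sign_bound|].
    replace (Finite 0) with (Finite (2 - 2)) by (f_equal; ring).
    apply is_lim_seq_minus'; [apply is_lim_seq_const|apply kernel_sum_diff_lim].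
Qed.

Lemma odd_sum_reflect (f : Z -> R) (m : nat) : odd_sum (fun k => f (- k)%Z) m = odd_sum f m.
Proof.
  induction m as [|m IH].
  - rewrite !odd_sum_0. simpl. ring.
  - rewrite !odd_sum_S, IH, Z.opp_involutive. ring.
Qed.

Lemma alt_rest_lim (i : Z) : is_lim_seq (alt_rest (1 + 2 * i)) 0.
Proof.
  induction i as [|i IH|i IH] using Z.peano_ind.
  - simpl Z.add.
    (* The indices 1 and -1 are neighbours with equal sums, so the sum of
       neighbours determines each of them. *)
    assert (e : forall m, alt_rest (-1) m = alt_rest 1 m).
    { intros m. unfold alt_rest. f_equal. unfold alt_sum.
      rewrite <- odd_sum_reflect. apply odd_sum_ext. intros k _.
      rewrite quarter_sign_opp. replace (-1 - - k)%Z with (- (1 - k))%Z by lia.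
      rewrite kernel_opp. ring. }
    apply (is_lim_seq_ext (fun m => (alt_rest (-1 + 2) m + alt_rest (-1) m) * / 2)).
    + intros m. rewrite e. simpl Z.add. field.
    + replace (Finite 0) with (Finite (0 * / 2)) by (f_equal; ring).
      apply is_lim_seq_mult'; [apply alt_rest_step_lim|apply is_lim_seq_const].
  - replace (1 + 2 * Z.succ i)%Z with (1 + 2 * i + 2)%Z by lia.
    apply (is_lim_seq_ext (fun m => (alt_rest (1 + 2 * i + 2) m + alt_rest (1 + 2 * i) m)
      - alt_rest (1 + 2 * i) m)); [intros; ring|].
    replace (Finite 0) with (Finite (0 - 0)) by (f_equal; ring).
    apply is_lim_seq_minus'; [apply alt_rest_step_lim|exact IH].
  - set (j := (1 + 2 * Z.pred i)%Z).
    replace (1 + 2 * i)%Z with (j + 2)%Z in IH by (unfold j; lia).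
    apply (is_lim_seq_ext (fun m => (alt_rest (j + 2) m + alt_rest j m) - alt_rest (j + 2) m));
      [intros; ring|].
    replace (Finite 0) with (Finite (0 - 0)) by (f_equal; ring).
    apply is_lim_seq_minus'; [apply alt_rest_step_lim|exact IH].
Qed.

(** The cosine coefficients of [t |-> S (t + PI / 2)]. *)
Definition quarter_coef (k : Z) : R := quarter_sign k * theta_coef k.

Lemma quarter_coef_opp (k : Z) : quarter_coef (- k) = quarter_coef k.
Proof.
  unfold quarter_coef. rewrite quarter_sign_opp, theta_coef_opp.
  generalize (quarter_sign_even k). destruct (Z.odd k); intros h; [ring|].
  rewrite h by reflexivity. ring.
Qed.

Lemma decays_quarter : decays quarter_coef.
Proof.
  apply (decays_ext (fun k => theta_coef k * quarter_sign k)).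
  - intros k. unfold quarter_coef. ring.
  - apply decays_mult_bounded; [apply quarter_sign_bound|apply decays_theta].
Qed.

(** The proportionality constant of [quarter_conv], read off at index 1. In
[cn_speed] it is expressed through values of the three functions. *)
Definition quarter_ratio : R :=
  zsum (fun k => quarter_coef k * dn_coef (1 - k)) / cn_coef 1.

Lemma cn_coef_neq_0 (k : Z) : Z.odd k = true -> cn_coef k <> 0.
Proof. intros h. unfold cn_coef. rewrite h. apply Rinv_neq_0_compat, ch_neq_0. Qed.

(** After division by the expected coefficient, [j] enters only through
[kernel (j - k)]; by [alt_rest_lim] the partial sums for two odd values of [j]
differ by a null sequence. *)
Lemma quarter_ratio_odd (j : Z) : Z.odd j = true ->
  is_lim_seq (odd_sum (fun k => quarter_sign k * (kernel k + kernel (j - k))))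
    (zsum (fun k => quarter_coef k * dn_coef (j - k)) / cn_coef j).
Proof.
  intros hj.
  assert (hn := cn_coef_neq_0 j hj).
  set (f := fun k => / cn_coef j * (quarter_coef k * dn_coef (j - k))).
  assert (e : forall k, f k = odd_part f k).
  { intros k. unfold odd_part, f, quarter_coef. generalize (quarter_sign_even k).
    destruct (Z.odd k); intros h; [reflexivity|]. rewrite h by reflexivity. ring. }
  assert (hf : decays f).
  { apply decays_scal, decays_conv; [apply decays_quarter|apply decays_dn]. }
  assert (hc := odd_sum_cvg f (decays_ext _ _ e hf)).
  rewrite <- (zsum_ext _ _ e) in hc. unfold f in hc at 2. rewrite zsum_scal in hc.
  unfold Rdiv. rewrite Rmult_comm.
  apply (is_lim_seq_ext _ (odd_sum (fun k => quarter_sign k * (kernel k + kernel (j - k))))) in hc;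
    [exact hc|].
  intros m. apply odd_sum_ext. intros k hk. unfold f, quarter_coef.
  rewrite Rmult_assoc, (theta_dn_split j k hk hj). field. exact hn.
Qed.

(** The quotient of the two sides does not depend on [j], by comparison of [j]
with index 1. *)
Lemma quarter_conv (j : Z) :
  zsum (fun k => quarter_coef k * dn_coef (j - k)) = quarter_ratio * cn_coef j.
Proof.
  destruct (Z.odd j) eqn:hj.
  - assert (h1 := quarter_ratio_odd j hj).
    assert (h2 := quarter_ratio_odd 1 eq_refl).
    assert (h3 := is_lim_seq_minus' _ _ _ _ h1 h2).
    assert (h4 : is_lim_seq (fun m => alt_rest j m - alt_rest 1 m) (0 - 0)).
    { apply is_lim_seq_minus'.
      - rewrite (Zdiv2_odd_eqn j), hj, Z.add_comm. apply alt_rest_lim.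
      - apply (alt_rest_lim 0). }
    apply (is_lim_seq_ext _ (fun m => alt_rest j m - alt_rest 1 m)) in h3.
    + assert (h := lim_seq_inj _ _ _ h3 h4). fold quarter_ratio in h.
      apply (Rmult_eq_reg_r (/ cn_coef j)).
      2: apply Rinv_neq_0_compat, cn_coef_neq_0, hj.
      rewrite Rmult_assoc, Rinv_r by (apply cn_coef_neq_0, hj).
      unfold Rdiv in h at 1. lra.
    + intros m. unfold alt_rest, alt_sum.
      rewrite (odd_sum_ext _ (fun k => quarter_sign k * kernel k + quarter_sign k * kernel (j - k)))
        by (intros; ring).
      rewrite (odd_sum_ext (fun k => quarter_sign k * (kernel k + kernel (1 - k)))
        (fun k => quarter_sign k * kernel k + quarter_sign k * kernel (1 - k)))
        by (intros; ring).
      rewrite !odd_sum_plus. ring.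
  - unfold cn_coef at 1. rewrite hj, Rmult_0_r.
    rewrite (zsum_ext _ (fun _ => 0 * 0)).
    + rewrite (zsum_scal 0 (fun _ => 0)). ring.
    + intros k. unfold quarter_coef, dn_coef. rewrite Z.odd_sub, hj.
      generalize (quarter_sign_even k). destruct (Z.odd k); simpl; intros h.
      * ring.
      * rewrite h by reflexivity. ring.
Qed.

End Elliptic.

(** * The pendulum angle and the delay equation *)

Lemma Rabs_cos_le_1 (x : R) : Rabs (cos x) <= 1.
Proof. apply Rabs_le, COS_bound. Qed.

Lemma Rabs_sin_le_1 (x : R) : Rabs (sin x) <= 1.
Proof. apply Rabs_le, SIN_bound. Qed.

Lemma zsum_sin_derive (a : Z -> R) (t : R) : decays a ->
  is_derive (fun t => zsum (fun n => a n * sin (IZR n * t))) t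
    (zsum (fun n => IZR n * a n * cos (IZR n * t))).
Proof.
  intros ha. apply (zsum_derive a sin cos ha Rabs_sin_le_1 Rabs_cos_le_1).
  apply first_order_bound; [intros; apply is_derive_sin|apply cos_lipschitz].
Qed.

Lemma zsum_cos_derive (a : Z -> R) (t : R) : decays a ->
  is_derive (fun t => zsum (fun n => a n * cos (IZR n * t))) t
    (- zsum (fun n => IZR n * a n * sin (IZR n * t))).
Proof.
  intros ha.
  assert (hd := zsum_derive a cos (fun x => - sin x) ha Rabs_cos_le_1).
  rewrite <- (Rmult_1_l (zsum _)), Ropp_mult_distr_l, <- zsum_scal.
  rewrite (zsum_ext (fun n => -(1) * _) (fun n => IZR n * a n * - sin (IZR n * t)))
    by (intros; ring).
  apply hd.
  - intros x. rewrite Rabs_Ropp. apply Rabs_sin_le_1.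
  - apply first_order_bound; [intros; apply is_derive_cos|].
    intros x y. replace (- sin x - - sin y) with (- (sin x - sin y)) by ring.
    rewrite Rabs_Ropp. apply sin_lipschitz.
Qed.

Lemma zero_derive_const (f : R -> R) (h : forall t, is_derive f t 0) (t : R) : f t = f 0.
Proof.
  destruct (MVT_gen f 0 t (fun _ => 0)) as [c [_ e]].
  - intros; apply h.
  - intros x _. apply derivable_continuous_pt. exists 0. apply is_derive_Reals, h.
  - lra.
Qed.

Lemma cos_odd_PI (k : Z) (x : R) : Z.odd k = true -> cos (x + IZR k * PI) = - cos x.
Proof.
  intros h. rewrite (Zdiv2_odd_eqn k), h, plus_IZR, mult_IZR.
  replace (x + (2 * IZR (Z.div2 k) + 1) * PI) with (x + 2 * IZR (Z.div2 k) * PI + PI) by ring.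
  rewrite neg_cos. f_equal.
  destruct (Z_le_dec 0 (Z.div2 k)) as [l|l].
  - rewrite <- (Z2Nat.id (Z.div2 k)), <- INR_IZR_INZ by assumption. apply cos_period.
  - rewrite <- (cos_period (x + 2 * IZR (Z.div2 k) * PI) (Z.to_nat (- Z.div2 k))).
    rewrite INR_IZR_INZ, Z2Nat.id, opp_IZR by lia. f_equal. ring.
Qed.

Lemma sin_odd_PI (k : Z) (x : R) : Z.odd k = true -> sin (x + IZR k * PI) = - sin x.
Proof.
  intros h. rewrite <- !(cos_shift (_ + _)), <- cos_shift.
  rewrite <- (cos_odd_PI (- k) (PI / 2 - x)) by (rewrite Z.odd_opp; exact h).
  f_equal. rewrite opp_IZR. ring.
Qed.

Section Angle.
Variable lam : R.
Hypothesis lam_pos : 0 < lam.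

Notation c := (cn_coef lam).
Notation w := (theta_coef lam).

Definition cn_fun (t : R) : R := zsum (fun k => c k * cos (IZR k * t)).
Definition dn_fun (t : R) : R := zsum (fun k => w k * cos (IZR k * t)).
Definition sn_fun (t : R) : R := zsum (fun k => w k * sin (IZR k * t)).
(** At [k = 0] the quotient is [0], since [cn_coef] vanishes at even indices. *)
Definition angle_coef (k : Z) : R := c k / IZR k.
(** Half of the pendulum angle: its derivative is [cn_fun], and its sine is
proportional to sn. *)
Definition angle (t : R) : R := zsum (fun k => angle_coef k * sin (IZR k * t)).

Lemma decays_angle : decays angle_coef.
Proof.
  apply (decays_le c); [|apply decays_cn, lam_pos].
  intros k. unfold angle_coef. destruct (Z.odd k) eqn:hk.
  - unfold Rdiv. rewrite Rabs_mult, Rabs_inv.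
    assert (h : 1 <= Rabs (IZR k)).
    { rewrite <- abs_IZR. apply IZR_le. destruct k; try discriminate; simpl; lia. }
    apply Rinv_le_contravar in h; [|lra]. rewrite Rinv_1 in h.
    generalize (Rabs_pos (c k)). nra.
  - unfold cn_coef. rewrite hk. unfold Rdiv. rewrite Rmult_0_l. lra.
Qed.

Lemma angle_coef_even (k : Z) : Z.odd k = false -> angle_coef k = 0.
Proof. intros h. unfold angle_coef, cn_coef. rewrite h. unfold Rdiv. ring. Qed.

Lemma angle_coef_opp (k : Z) : angle_coef (- k) = - angle_coef k.
Proof.
  unfold angle_coef. rewrite cn_coef_opp, opp_IZR. unfold Rdiv. rewrite Rinv_opp. ring.
Qed.

Lemma index_angle_coef (k : Z) : IZR k * angle_coef k = c k.
Proof.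
  destruct (Z.odd k) eqn:hk.
  - unfold angle_coef. field. apply not_0_IZR. intros e. rewrite e in hk. discriminate.
  - rewrite angle_coef_even by assumption. unfold cn_coef. rewrite hk. ring.
Qed.

Lemma angle_derive (t : R) : is_derive angle t (cn_fun t).
Proof.
  unfold cn_fun.
  rewrite <- (zsum_ext (fun k => IZR k * angle_coef k * cos (IZR k * t)))
    by (intros; rewrite index_angle_coef; reflexivity).
  apply zsum_sin_derive, decays_angle.
Qed.

(** Multiplication by [cn_fun] acts on the combined series of dn and sn as
multiplication of the coefficients by their index. *)
Lemma cn_times_theta (e : Z -> R) (t : R)
  (e_bound : forall j, Rabs (e j) <= 1)
  (e_cos : forall j k, e (j + k)%Z + e (j - k)%Z = 2 * cos (IZR k * t) * e j) :
  cn_fun t * zsum (fun j => w j * e j) = zsum (fun j => IZR j * w j * e j).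
Proof.
  unfold cn_fun.
  rewrite (zsum_conv c w e t (cn_coef_opp lam) (decays_cn lam lam_pos) (decays_theta lam lam_pos)
    e_bound e_cos).
  apply zsum_ext. intros j. rewrite cn_theta_conv by assumption. reflexivity.
Qed.

Lemma cos_product_to_sum (t : R) (j k : Z) :
  cos (IZR (j + k) * t) + cos (IZR (j - k) * t) = 2 * cos (IZR k * t) * cos (IZR j * t).
Proof.
  rewrite plus_IZR, minus_IZR, Rmult_plus_distr_r, Rmult_minus_distr_r, cos_plus, cos_minus.
  ring.
Qed.

Lemma sin_product_to_sum (t : R) (j k : Z) :
  sin (IZR (j + k) * t) + sin (IZR (j - k) * t) = 2 * cos (IZR k * t) * sin (IZR j * t).
Proof.
  rewrite plus_IZR, minus_IZR, Rmult_plus_distr_r, Rmult_minus_distr_r, sin_plus, sin_minus.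
  ring.
Qed.

Lemma sn_derive (t : R) : is_derive sn_fun t (cn_fun t * dn_fun t).
Proof.
  unfold dn_fun.
  rewrite (cn_times_theta (fun j => cos (IZR j * t)) t
    (fun j => Rabs_cos_le_1 _) (cos_product_to_sum t)).
  apply zsum_sin_derive, decays_theta, lam_pos.
Qed.

Lemma dn_derive (t : R) : is_derive dn_fun t (- (cn_fun t * sn_fun t)).
Proof.
  unfold sn_fun.
  rewrite (cn_times_theta (fun j => sin (IZR j * t)) t
    (fun j => Rabs_sin_le_1 _) (sin_product_to_sum t)).
  apply zsum_cos_derive, decays_theta, lam_pos.
Qed.

Lemma zsum_sin_at_0 (a : Z -> R) : zsum (fun k => a k * sin (IZR k * 0)) = 0.
Proof.
  rewrite (zsum_ext _ (fun k => 0 * 0)).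
  - rewrite (zsum_scal 0 (fun _ => 0)). ring.
  - intros k. rewrite Rmult_0_r, sin_0. ring.
Qed.

(** By [sn_derive] and [dn_derive] the point [(D, S)] turns with angular speed
[cn_fun], the derivative of [angle]. Hence its coordinates in the frame turned
by [angle] have zero derivative. *)
Lemma angle_polar (t : R) :
  dn_fun t = dn_fun 0 * cos (angle t) /\ sn_fun t = dn_fun 0 * sin (angle t).
Proof.
  assert (h1 : dn_fun t * cos (angle t) + sn_fun t * sin (angle t) = dn_fun 0).
  { rewrite (zero_derive_const (fun t => dn_fun t * cos (angle t) + sn_fun t * sin (angle t))).
    - unfold angle, sn_fun. rewrite !zsum_sin_at_0, cos_0. ring.
    - intros s. evar_last.
      + apply (is_derive_plus (K:=R_AbsRing) (V:=R_NormedModule)); apply (is_derive_mult (K:=R_AbsRing)).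
        * apply dn_derive.
        * apply is_derive_comp; [apply is_derive_cos|apply angle_derive].
        * intros; apply Rmult_comm.
        * apply sn_derive.
        * apply is_derive_comp; [apply is_derive_sin|apply angle_derive].
        * intros; apply Rmult_comm.
      + unfold plus, mult, scal; simpl; unfold mult; simpl. ring. }
  assert (h2 : sn_fun t * cos (angle t) - dn_fun t * sin (angle t) = 0).
  { rewrite (zero_derive_const (fun t => sn_fun t * cos (angle t) - dn_fun t * sin (angle t))).
    - unfold angle, sn_fun. rewrite !zsum_sin_at_0, sin_0. ring.
    - intros s. evar_last.
      + apply (is_derive_minus (K:=R_AbsRing) (V:=R_NormedModule)); apply (is_derive_mult (K:=R_AbsRing)).
        * apply sn_derive.
        * apply is_derive_comp; [apply is_derive_cos|apply angle_derive].
        * intros; apply Rmult_comm.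
        * apply dn_derive.
        * apply is_derive_comp; [apply is_derive_sin|apply angle_derive].
        * intros; apply Rmult_comm.
      + unfold minus, plus, opp, mult, scal; simpl; unfold mult; simpl. ring. }
  assert (h3 := sin2_cos2 (angle t)). unfold Rsqr in h3.
  rewrite <- h1. split.
  - transitivity (dn_fun t * (sin (angle t) * sin (angle t) + cos (angle t) * cos (angle t))
      + sin (angle t) * (sn_fun t * cos (angle t) - dn_fun t * sin (angle t))).
    + rewrite h2, h3. ring.
    + ring.
  - transitivity (sn_fun t * (sin (angle t) * sin (angle t) + cos (angle t) * cos (angle t))
      - cos (angle t) * (sn_fun t * cos (angle t) - dn_fun t * sin (angle t))).
    + rewrite h2, h3. ring.
    + ring.
Qed.

Lemma dn_fun_even_part (t : R) : dn_fun t = zsum (fun k => dn_coef lam k * cos (IZR k * t)).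
Proof.
  assert (g : forall a, decays a -> decays (fun k => a k * cos (IZR k * t))).
  { intros a ha. apply (decays_mult_bounded a (fun k => cos (IZR k * t))); [|exact ha].
    intros; apply Rabs_cos_le_1. }
  apply Rminus_diag_uniq. unfold dn_fun. rewrite <- zsum_minus.
  - apply zsum_odd. intros k. rewrite theta_coef_opp by assumption.
    rewrite opp_IZR, Ropp_mult_distr_l_reverse, cos_neg.
    unfold dn_coef, theta_coef. rewrite Z.odd_opp, ch_opp. destruct (Z.odd k); ring.
  - apply g, decays_theta, lam_pos.
  - apply g, decays_dn, lam_pos.
Qed.

Lemma sn_fun_quarter (t : R) :
  sn_fun (t + PI / 2) = zsum (fun k => quarter_coef lam k * cos (IZR k * t)).
Proof.
  assert (g : forall s, decays (fun k => w k * sin (IZR k * s))).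
  { intros s. apply (decays_mult_bounded w (fun k => sin (IZR k * s))).
    - intros; apply Rabs_sin_le_1.
    - apply decays_theta, lam_pos. }
  apply Rminus_diag_uniq. unfold sn_fun. rewrite <- zsum_minus.
  - apply zsum_odd. intros k. unfold quarter_coef.
    rewrite quarter_sign_opp, theta_coef_opp by assumption.
    unfold quarter_sign. rewrite opp_IZR.
    replace (- IZR k * (t + PI / 2)) with (- (IZR k * t + IZR k * (PI / 2))) by ring.
    replace (IZR k * (t + PI / 2)) with (IZR k * t + IZR k * (PI / 2)) by ring.
    rewrite !Ropp_mult_distr_l_reverse, cos_neg, !sin_neg, sin_plus.
    destruct (Z.odd k) eqn:hk.
    + rewrite (cos_odd_PI2 k hk). ring.
    + assert (e := quarter_sign_even k hk). unfold quarter_sign in e. rewrite e. ring.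
  - apply g.
  - apply (decays_mult_bounded (quarter_coef lam) (fun k => cos (IZR k * t))).
    + intros; apply Rabs_cos_le_1.
    + apply decays_quarter, lam_pos.
Qed.

(** The elliptic identity dn(t) sn(t + T/4) = const * cn(t), with [T] the
period. *)
Lemma dn_sn_quarter (t : R) :
  dn_fun t * sn_fun (t + PI / 2) = quarter_ratio lam * cn_fun t.
Proof.
  rewrite sn_fun_quarter, dn_fun_even_part, Rmult_comm.
  rewrite (zsum_conv (quarter_coef lam) (dn_coef lam) (fun j => cos (IZR j * t)) t
    (quarter_coef_opp lam lam_pos) (decays_quarter lam lam_pos) (decays_dn lam lam_pos)
    (fun j => Rabs_cos_le_1 _) (cos_product_to_sum t)).
  unfold cn_fun. rewrite <- zsum_scal. apply zsum_ext. intros j.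
  rewrite quarter_conv by assumption. ring.
Qed.

Lemma angle_half_period (t : R) : angle (t + PI) = - angle t.
Proof.
  unfold angle. rewrite <- (Rmult_1_l (zsum (fun k => angle_coef k * sin (IZR k * t)))),
    Ropp_mult_distr_l, <- zsum_scal.
  apply zsum_ext. intros k. destruct (Z.odd k) eqn:hk.
  - rewrite Rmult_plus_distr_l, (sin_odd_PI k _ hk). ring.
  - rewrite angle_coef_even by assumption. ring.
Qed.

Hypothesis dn_pos : 0 < dn_fun 0.
Hypothesis cn_pos : 0 < cn_fun 0.
Hypothesis sn_pos : 0 < sn_fun (PI / 2).

(** The constant [A] in [u' = A cos u sin v], computed at [t = 0]. *)
Definition speed : R := dn_fun 0 * cn_fun 0 / sn_fun (PI / 2).

Lemma cn_speed (t : R) : cn_fun t = speed * cos (angle t) * sin (angle (t + PI / 2)).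
Proof.
  assert (h := dn_sn_quarter t). assert (h0 := dn_sn_quarter 0).
  rewrite Rplus_0_l in h0.
  rewrite (proj1 (angle_polar t)), (proj2 (angle_polar (t + PI / 2))) in h.
  assert (e : quarter_ratio lam = dn_fun 0 * sn_fun (PI / 2) / cn_fun 0).
  { rewrite h0. field. lra. }
  rewrite e in h. unfold speed.
  apply (Rmult_eq_reg_l (dn_fun 0 * sn_fun (PI / 2) / cn_fun 0)).
  - rewrite <- h. field. lra.
  - apply Rgt_not_eq. apply Rdiv_lt_0_compat; [|assumption].
    apply Rmult_lt_0_compat; assumption.
Qed.

Definition orbit (t : R) : R := angle t + angle (t + PI / 2).

(** With [u = angle t] and [v = angle (t + PI / 2)], [cn_speed] at [t] and at
[t + PI / 2] gives [orbit' = - A sin (u - v)], and the antisymmetry of [angle]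
under half a period identifies [u - v] with [orbit (t - PI / 2)]. *)
Lemma orbit_derive (t : R) : is_derive orbit t (- speed * sin (orbit (t - PI / 2))).
Proof.
  evar_last.
  - apply (is_derive_plus (K:=R_AbsRing) (V:=R_NormedModule)); [apply angle_derive|].
    apply (is_derive_comp angle (fun t => t + PI / 2)); [apply angle_derive|].
    apply (is_derive_plus (K:=R_AbsRing) (V:=R_NormedModule)); [apply is_derive_id|apply is_derive_const].
  - unfold plus, scal, one, zero; simpl; unfold mult; simpl.
    rewrite (cn_speed t), (cn_speed (t + PI / 2)).
    replace (t + PI / 2 + PI / 2) with (t + PI) by field.
    assert (e : angle (t - PI / 2) = - angle (t + PI / 2)).
    { rewrite <- (Ropp_involutive (angle (t - PI / 2))), <- angle_half_period.
      do 2 f_equal. field. }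
    unfold orbit. replace (t - PI / 2 + PI / 2) with t by ring.
    rewrite e, angle_half_period, sin_plus, !sin_neg, cos_neg. ring.
Qed.

Lemma orbit_periodic (t : R) : orbit (t + 2 * PI) = orbit t.
Proof.
  unfold orbit.
  replace (t + 2 * PI + PI / 2) with (t + PI / 2 + PI + PI) by ring.
  replace (t + 2 * PI) with (t + PI + PI) by ring.
  rewrite !angle_half_period. ring.
Qed.

End Angle.

(** * Choice of the nome *)

(** The truncated geometric series differs from [1 / (1 + x ^ 2)] by
[x ^ 14 / (1 + x ^ 2)], so the difference of the two sides is monotone. *)
Lemma atan_upper (x : R) : 0 <= x ->
  atan x <= x - x ^ 3 / 3 + x ^ 5 / 5 - x ^ 7 / 7 + x ^ 9 / 9 - x ^ 11 / 11 + x ^ 13 / 13.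
Proof.
  intros hx.
  set (f := fun x => x - x ^ 3 / 3 + x ^ 5 / 5 - x ^ 7 / 7 + x ^ 9 / 9 - x ^ 11 / 11 + x ^ 13 / 13
    - atan x).
  assert (hd : forall y, is_derive f y (y ^ 14 / (1 + y ^ 2))).
  { intros y. assert (0 < 1 + y ^ 2) by (generalize (pow2_ge_0 y); lra).
    unfold f. auto_derive; [exact I|]. field. lra. }
  destruct (MVT_gen f 0 x (fun y => y ^ 14 / (1 + y ^ 2))) as [c [_ e]].
  - intros y _. apply hd.
  - intros y _. apply derivable_continuous_pt. eexists. apply is_derive_Reals, hd.
  - assert (h0 : f 0 = 0) by (unfold f; rewrite atan_0; field).
    rewrite h0 in e.
    assert (0 <= c ^ 14 / (1 + c ^ 2) * (x - 0)).
    { apply Rmult_le_pos; [|lra]. apply Rmult_le_pos.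
      - replace (c ^ 14) with ((c ^ 7) ^ 2) by ring. apply pow2_ge_0.
      - left. apply Rinv_0_lt_compat. generalize (pow2_ge_0 c). lra. }
    unfold f in e. lra.
Qed.

Lemma atan_lower (x : R) : 0 <= x ->
  x - x ^ 3 / 3 + x ^ 5 / 5 - x ^ 7 / 7 + x ^ 9 / 9 - x ^ 11 / 11 + x ^ 13 / 13 - x ^ 15 / 15
  <= atan x.
Proof.
  intros hx.
  set (f := fun x => atan x - (x - x ^ 3 / 3 + x ^ 5 / 5 - x ^ 7 / 7 + x ^ 9 / 9 - x ^ 11 / 11
    + x ^ 13 / 13 - x ^ 15 / 15)).
  assert (hd : forall y, is_derive f y (y ^ 16 / (1 + y ^ 2))).
  { intros y. assert (0 < 1 + y ^ 2) by (generalize (pow2_ge_0 y); lra).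
    unfold f. auto_derive; [exact I|]. field. lra. }
  destruct (MVT_gen f 0 x (fun y => y ^ 16 / (1 + y ^ 2))) as [c [_ e]].
  - intros y _. apply hd.
  - intros y _. apply derivable_continuous_pt. eexists. apply is_derive_Reals, hd.
  - assert (h0 : f 0 = 0) by (unfold f; rewrite atan_0; field).
    rewrite h0 in e.
    assert (0 <= c ^ 16 / (1 + c ^ 2) * (x - 0)).
    { apply Rmult_le_pos; [|lra]. apply Rmult_le_pos.
      - replace (c ^ 16) with ((c ^ 8) ^ 2) by ring. apply pow2_ge_0.
      - left. apply Rinv_0_lt_compat. generalize (pow2_ge_0 c). lra. }
    unfold f in e. lra.
Qed.

(** Machin's formula. *)
Lemma PI_bounds : 3.141592653 < PI < 3.141592654.
Proof.
  generalize Machin_4_5_239.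
  generalize (atan_upper (/ 5)), (atan_lower (/ 5)), (atan_upper (/ 239)), (atan_lower (/ 239)).
  intros a1 a2 a3 a4.
  assert (b1 := a1 ltac:(lra)). assert (b2 := a2 ltac:(lra)).
  assert (b3 := a3 ltac:(lra)). assert (b4 := a4 ltac:(lra)).
  intros m. split; lra.
Qed.

(** The terms of [D 0], [C 0] and [S (PI / 2)] as functions of the nome
[q = exp (- 2 lam)], with the common factor [4 * exp (- lam)] of the last two
removed since it cancels in [speed]. *)
Definition dn_term (q : R) (i : nat) : R :=
  match i with O => 1 | S _ => 4 * q ^ i / (1 + q ^ (2 * i)) end.
Definition cn_term (q : R) (i : nat) : R := q ^ i / (1 + q ^ (2 * i + 1)).
Definition sn_term (q : R) (i : nat) : R := (-1) ^ i * q ^ i / (1 - q ^ (2 * i + 1)).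

Lemma Rabs_pow_small (q : R) (n : nat) : Rabs q <= 1 / 10 -> Rabs (q ^ S n) <= 1 / 10.
Proof.
  intros h. rewrite <- tech_pow_Rmult, Rabs_mult, <- RPow_abs.
  assert (Rabs q ^ n <= 1) by (rewrite <- (pow1 n); apply pow_incr; split; [apply Rabs_pos|lra]).
  assert (0 <= Rabs q ^ n) by (apply pow_le, Rabs_pos).
  generalize (Rabs_pos q). nra.
Qed.

Lemma quotient_bound (a d : R) : 9 / 10 <= d -> Rabs (a / d) <= 5 / 4 * Rabs a.
Proof.
  intros h. unfold Rdiv. rewrite Rabs_mult, (Rabs_pos_eq (/ d)).
  - assert (/ d <= 5 / 4).
    { apply (Rmult_le_reg_l d); [lra|]. rewrite Rinv_r; lra. }
    generalize (Rabs_pos a). nra.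
  - left. apply Rinv_0_lt_compat. lra.
Qed.

Lemma even_power_small (q : R) (i : nat) : Rabs q <= 1 / 10 -> 9 / 10 <= 1 + q ^ (2 * S i).
Proof.
  intros h. generalize (Rabs_pow_small q (2 * i + 1) h).
  replace (2 * S i)%nat with (S (2 * i + 1)) by lia. unfold Rabs at 1.
  destruct (Rcase_abs (q ^ S (2 * i + 1))); lra.
Qed.

Lemma dn_term_bound (q : R) (i : nat) : Rabs q <= 1 / 10 -> Rabs (dn_term q i) <= 5 * Rabs q ^ i.
Proof.
  intros h. destruct i as [|i]; unfold dn_term.
  - simpl. rewrite Rabs_R1. lra.
  - eapply Rle_trans; [apply quotient_bound, even_power_small, h|].
    rewrite Rabs_mult, <- RPow_abs, (Rabs_pos_eq 4) by lra. lra.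
Qed.

Lemma odd_power_small (q : R) (i : nat) : Rabs q <= 1 / 10 ->
  9 / 10 <= 1 + q ^ (2 * i + 1) /\ 9 / 10 <= 1 - q ^ (2 * i + 1).
Proof.
  intros h. generalize (Rabs_pow_small q (2 * i) h).
  replace (2 * i + 1)%nat with (S (2 * i)) by lia. unfold Rabs at 1.
  destruct (Rcase_abs (q ^ S (2 * i))); lra.
Qed.

Lemma cn_term_bound (q : R) (i : nat) : Rabs q <= 1 / 10 -> Rabs (cn_term q i) <= 5 * Rabs q ^ i.
Proof.
  intros h. unfold cn_term. eapply Rle_trans; [apply quotient_bound, odd_power_small, h|].
  rewrite <- RPow_abs. assert (0 <= Rabs q ^ i) by (apply pow_le, Rabs_pos). lra.
Qed.

Lemma sn_term_bound (q : R) (i : nat) : Rabs q <= 1 / 10 -> Rabs (sn_term q i) <= 5 * Rabs q ^ i.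
Proof.
  intros h. unfold sn_term. eapply Rle_trans; [apply quotient_bound, odd_power_small, h|].
  rewrite Rabs_mult, pow_1_abs, <- RPow_abs.
  assert (0 <= Rabs q ^ i) by (apply pow_le, Rabs_pos). lra.
Qed.

Section Term_series.
Variable term : R -> nat -> R.
Hypothesis term_bound : forall q i, Rabs q <= 1 / 10 -> Rabs (term q i) <= 5 * Rabs q ^ i.

Lemma term_series_continuous (q : R)
  (hc : forall i x, Rabs x < 1 / 10 -> continuity_pt (fun x => term x i) x) :
  Rabs q < 1 / 10 -> continuity_pt (fun x => Series (term x)) q.
Proof.
  intros hq. set (r := mkposreal (1 / 10) ltac:(lra)).
  assert (hn : CVN_r (fun i x => term x i) r).
  { exists (fun i => 5 * (1 / 10) ^ i), (5 / (1 - 1 / 10)). split.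
    - apply is_series_Reals.
      apply (is_series_ext (fun i => 5 * (1 / 10) ^ i)).
      + intros i. rewrite Rabs_pos_eq; [reflexivity|].
        apply Rmult_le_pos; [lra|]. apply pow_le. lra.
      + apply is_series_geom_scal. lra.
    - intros i x hx. unfold Boule in hx. simpl in hx. rewrite Rminus_0_r in hx.
      eapply Rle_trans; [apply term_bound; lra|].
      apply Rmult_le_compat_l; [lra|]. apply pow_incr. split; [apply Rabs_pos|lra]. }
  assert (hr : 0 < 1 / 10 - Rabs q) by lra.
  destruct (CVN_CVU_r _ r hn q hq) as [e he].
  set (e' := mkposreal (Rmin e (1 / 10 - Rabs q)) (Rmin_glb_lt _ _ _ (cond_pos e) hr)).
  apply (CVU_continuity (fun n => SP (fun i x => term x i) n)
    (fun x => Series (term x)) q e').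
  - intros eps heps. destruct (he eps heps) as [N hN]. exists N. intros n y hn' hy.
    apply hN; [assumption|]. unfold Boule in *. simpl in *.
    eapply Rlt_le_trans; [exact hy|apply Rmin_l].
  - intros n y hy. unfold SP.
    assert (ha : Rabs y < 1 / 10).
    { unfold Boule in hy. simpl in hy.
      generalize (Rmin_r e (1 / 10 - Rabs q)). generalize (Rabs_triang_inv y q). lra. }
    induction n as [|n IH]; simpl.
    + apply hc, ha.
    + apply (continuity_pt_plus (fun x => sum_f_R0 (fun i => term x i) n)); [exact IH|apply hc, ha].
  - unfold Boule. rewrite Rminus_diag, Rabs_R0. apply cond_pos.
Qed.

Lemma term_ex_series (q : R) : Rabs q <= 1 / 10 -> ex_series (term q).
Proof.
  intros hq. apply (@ex_series_le R_AbsRing R_CompleteNormedModule _ (fun i => 5 * Rabs q ^ i)).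
  - intros i. apply term_bound, hq.
  - destruct (Req_dec q 0) as [->|hn].
    + rewrite Rabs_R0. exists (5 * / (1 - 0)).
      apply (@is_series_scal R_AbsRing R_NormedModule 5), is_series_geom.
      rewrite Rabs_R0. lra.
    + eexists. apply is_series_geom_scal. split; [apply Rabs_pos_lt, hn|lra].
Qed.

Lemma term_series_tail (q : R) (n : nat) : 0 < q <= 5 / 1000 ->
  Rabs (Series (term q) - sum_f_R0 (term q) n) <= 5 * q ^ S n / (1 - q).
Proof.
  intros hq.
  assert (ha : Rabs q = q) by (apply Rabs_pos_eq; lra).
  assert (hq' : Rabs q <= 1 / 10) by lra.
  rewrite (Series_incr_n _ (S n)) by (lia || apply term_ex_series, hq').
  simpl pred. rewrite Rplus_minus_l.
  assert (hg := is_series_geom_scal (5 * q ^ S n) q ltac:(lra)).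
  assert (hb : forall k, Rabs (term q (S n + k)) <= 5 * q ^ S n * q ^ k).
  { intros k. rewrite Rmult_assoc, <- pow_add. rewrite <- ha at 2. apply term_bound, hq'. }
  rewrite <- (is_series_unique _ _ hg).
  eapply Rle_trans; [apply Series_Rabs|apply Series_le].
  - apply (@ex_series_le R_AbsRing R_CompleteNormedModule _ (fun k => 5 * q ^ S n * q ^ k)).
    + intros k. change (Rabs (Rabs (term q (S n + k))) <= 5 * q ^ S n * q ^ k).
      rewrite Rabs_Rabsolu. apply hb.
    + eexists. exact hg.
  - intros k. split; [apply Rabs_pos|apply hb].
  - eexists. exact hg.
Qed.

Lemma term_series_approx (q : R) : 0 < q <= 5 / 1000 ->
  Rabs (Series (term q) - sum_f_R0 (term q) 4) <= 1 / 5000000000.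
Proof.
  intros hq. eapply Rle_trans; [apply term_series_tail, hq|].
  apply Rle_div_l; [lra|].
  assert (q ^ 5 <= (5 / 1000) ^ 5) by (apply pow_incr; lra). lra.
Qed.

Lemma term_series_pos (q : R) : 0 < q <= 5 / 1000 -> 9 / 10 <= term q 0 -> 0 < Series (term q).
Proof.
  intros hq h1. assert (h := term_series_tail q 0 hq). simpl sum_f_R0 in h.
  assert (5 * q ^ 1 / (1 - q) <= 1 / 2) by (apply Rle_div_l; lra).
  apply Rabs_le_between in h. lra.
Qed.

End Term_series.

Lemma dn_term_continuous (i : nat) (x : R) :
  Rabs x < 1 / 10 -> continuity_pt (fun x => dn_term x i) x.
Proof.
  intros h. destruct i as [|i]; unfold dn_term.
  - apply continuity_pt_const. intros a b. reflexivity.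
  - apply continuity_pt_filterlim. apply (ex_derive_continuous (K:=R_AbsRing) (V:=R_NormedModule)
      (fun x => 4 * x ^ S i / (1 + x ^ (2 * S i)))).
    assert (h1 := even_power_small x i (Rlt_le _ _ h)).
    revert h1. generalize (2 * S i)%nat. intros n h1. auto_derive. lra.
Qed.

Lemma cn_term_continuous (i : nat) (x : R) :
  Rabs x < 1 / 10 -> continuity_pt (fun x => cn_term x i) x.
Proof.
  intros h. unfold cn_term. apply continuity_pt_filterlim.
  apply (ex_derive_continuous (K:=R_AbsRing) (V:=R_NormedModule)
      (fun x => x ^ i / (1 + x ^ (2 * i + 1)))).
  destruct (odd_power_small x i (Rlt_le _ _ h)) as [h1 h2].
  revert h1 h2. generalize (2 * i + 1)%nat. intros n h1 h2. auto_derive. lra.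
Qed.

Lemma sn_term_continuous (i : nat) (x : R) :
  Rabs x < 1 / 10 -> continuity_pt (fun x => sn_term x i) x.
Proof.
  intros h. unfold sn_term. apply continuity_pt_filterlim.
  apply (ex_derive_continuous (K:=R_AbsRing) (V:=R_NormedModule)
      (fun x => (-1) ^ i * x ^ i / (1 - x ^ (2 * i + 1)))).
  destruct (odd_power_small x i (Rlt_le _ _ h)) as [h1 h2].
  revert h1 h2. generalize (2 * i + 1)%nat. intros n h1 h2. auto_derive. lra.
Qed.

Definition dn_nome (q : R) : R := Series (dn_term q).
Definition cn_nome (q : R) : R := Series (cn_term q).
Definition sn_nome (q : R) : R := Series (sn_term q).
(** Zero exactly when the speed is [3.2 / PI]; written without quotients. *)
Definition speed_defect (q : R) : R := PI * (dn_nome q * cn_nome q) - 3.2 * sn_nome q.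

Lemma speed_defect_continuous (q : R) : Rabs q < 1 / 10 -> continuity_pt speed_defect q.
Proof.
  intros h. unfold speed_defect.
  apply (continuity_pt_minus (fun q => PI * (dn_nome q * cn_nome q)) (fun q => 3.2 * sn_nome q)).
  - apply (continuity_pt_scal (fun q => dn_nome q * cn_nome q)).
    apply (continuity_pt_mult dn_nome cn_nome); unfold dn_nome, cn_nome;
      apply term_series_continuous; auto using dn_term_bound, cn_term_bound, dn_term_continuous,
        cn_term_continuous.
  - apply (continuity_pt_scal sn_nome). unfold sn_nome.
    apply term_series_continuous; auto using sn_term_bound, sn_term_continuous.
Qed.

Lemma dn_nome_approx (q : R) : 0 < q <= 5 / 1000 ->
  Rabs (dn_nome q - (1 + 4 * q / (1 + q ^ 2) + 4 * q ^ 2 / (1 + q ^ 4) + 4 * q ^ 3 / (1 + q ^ 6)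
    + 4 * q ^ 4 / (1 + q ^ 8))) <= 1 / 5000000000.
Proof.
  intros h. generalize (term_series_approx dn_term dn_term_bound q h).
  unfold dn_nome, dn_term.
  match goal with |- Rabs (_ - ?a) <= _ -> Rabs (_ - ?b) <= _ => replace b with a; [auto|] end.
  unfold Rdiv. simpl. rewrite ?Rmult_1_r. ring.
Qed.

Lemma cn_nome_approx (q : R) : 0 < q <= 5 / 1000 ->
  Rabs (cn_nome q - (1 / (1 + q) + q / (1 + q ^ 3) + q ^ 2 / (1 + q ^ 5) + q ^ 3 / (1 + q ^ 7)
    + q ^ 4 / (1 + q ^ 9))) <= 1 / 5000000000.
Proof.
  intros h. generalize (term_series_approx cn_term cn_term_bound q h).
  unfold cn_nome, cn_term.
  match goal with |- Rabs (_ - ?a) <= _ -> Rabs (_ - ?b) <= _ => replace b with a; [auto|] end.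
  unfold Rdiv. simpl. rewrite ?Rmult_1_r. ring.
Qed.

Lemma sn_nome_approx (q : R) : 0 < q <= 5 / 1000 ->
  Rabs (sn_nome q - (1 / (1 - q) - q / (1 - q ^ 3) + q ^ 2 / (1 - q ^ 5) - q ^ 3 / (1 - q ^ 7)
    + q ^ 4 / (1 - q ^ 9))) <= 1 / 5000000000.
Proof.
  intros h. generalize (term_series_approx sn_term sn_term_bound q h).
  unfold sn_nome, sn_term.
  match goal with |- Rabs (_ - ?a) <= _ -> Rabs (_ - ?b) <= _ => replace b with a; [auto|] end.
  unfold Rdiv. simpl. rewrite ?Rmult_1_r. ring.
Qed.

(** The speed changes by about 4 times the change of the nome, so this interval
is wide enough for bounds on [PI] with error 1e-9 to detect the change of sign,
and narrow enough to locate the first Fourier coefficient within 6e-8. *)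
Definition nome_low : R := 0.004626503.
Definition nome_high : R := 0.004626505.

Lemma speed_defect_low : speed_defect nome_low < 0.
Proof.
  assert (h : 0 < nome_low <= 5 / 1000) by (unfold nome_low; lra).
  assert (d := dn_nome_approx nome_low h). assert (c := cn_nome_approx nome_low h).
  assert (s := sn_nome_approx nome_low h). assert (p := PI_bounds).
  apply Rabs_le_between in d, c, s. unfold speed_defect.
  assert (0 <= dn_nome nome_low <= 1.0185916323) by (unfold nome_low in *; lra).
  assert (0 <= cn_nome nome_low <= 1.0000428099) by (unfold nome_low in *; lra).
  assert (1.0000428092 <= sn_nome nome_low) by (unfold nome_low in *; lra).
  assert (0 <= dn_nome nome_low * cn_nome nome_low <= 1.0185916323 * 1.0000428099) by nra.
  nra.
Qed.

Lemma speed_defect_high : 0 < speed_defect nome_high.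
Proof.
  assert (h : 0 < nome_high <= 5 / 1000) by (unfold nome_high; lra).
  assert (d := dn_nome_approx nome_high h). assert (c := cn_nome_approx nome_high h).
  assert (s := sn_nome_approx nome_high h). assert (p := PI_bounds).
  apply Rabs_le_between in d, c, s. unfold speed_defect.
  assert (1.0185916397 <= dn_nome nome_high) by (unfold nome_high in *; lra).
  assert (1.0000428092 <= cn_nome nome_high) by (unfold nome_high in *; lra).
  assert (sn_nome nome_high <= 1.0000428099) by (unfold nome_high in *; lra).
  assert (1.0185916397 * 1.0000428092 <= dn_nome nome_high * cn_nome nome_high) by nra.
  nra.
Qed.

Lemma nome_exists : exists q, nome_low <= q <= nome_high /\ PI * (dn_nome q * cn_nome q) = 3.2 * sn_nome q.
Proof.
  destruct (IVT_interv speed_defect nome_low nome_high) as [q [h1 h2]].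
  - intros q hq. apply speed_defect_continuous. unfold nome_low, nome_high in hq.
    rewrite Rabs_pos_eq; lra.
  - unfold nome_low, nome_high. lra.
  - apply speed_defect_low.
  - apply speed_defect_high.
  - exists q. split; [exact h1|]. unfold speed_defect in h2. lra.
Qed.

Lemma dn_nome_pos (q : R) : 0 < q <= 5 / 1000 -> 0 < dn_nome q.
Proof. intros h. apply term_series_pos; [apply dn_term_bound|exact h|]. simpl. lra. Qed.

Lemma cn_nome_pos (q : R) : 0 < q <= 5 / 1000 -> 0 < cn_nome q.
Proof.
  intros h. apply term_series_pos; [apply cn_term_bound|exact h|].
  unfold cn_term. simpl. apply (Rle_div_r (9 / 10)); lra.
Qed.

Lemma sn_nome_pos (q : R) : 0 < q <= 5 / 1000 -> 0 < sn_nome q.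
Proof.
  intros h. apply term_series_pos; [apply sn_term_bound|exact h|].
  unfold sn_term. simpl. apply (Rle_div_r (9 / 10)); lra.
Qed.

Section Nome.
Variable lam : R.
Hypothesis lam_pos : 0 < lam.
Notation r := (exp (- lam)).
Notation q := (r * r).

(** Grouping in twos removes the zeros that the parity of the coefficients puts
in every other place. *)
Lemma is_series_even_odd (a : nat -> R) (l : R) :
  is_series a l -> is_series (fun i => a (2 * i)%nat + a (2 * i + 1)%nat) l.
Proof.
  intros h.
  change (is_lim_seq (sum_n (fun i => a (2 * i)%nat + a (2 * i + 1)%nat)) l).
  apply (is_lim_seq_ext (fun m => sum_n a (2 * m + 1))).
  - intros m. induction m as [|m IH].
    + simpl Nat.add. rewrite sum_Sn, !sum_O. reflexivity.
    + rewrite sum_Sn, <- IH.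
      replace (2 * S m + 1)%nat with (S (S (2 * m + 1))) by lia.
      replace (2 * S m)%nat with (S (2 * m + 1)) by lia.
      rewrite !sum_Sn. unfold plus; simpl. ring.
  - apply (is_lim_seq_subseq (sum_n a) l (fun m => 2 * m + 1)%nat); [|exact h].
    apply eventually_subseq. intros n. lia.
Qed.

Lemma exp_lam_index (n : nat) : exp (lam * IZR (Z.of_nat n)) = / r ^ n.
Proof.
  rewrite exp_pow, <- INR_IZR_INZ, <- exp_Ropp. f_equal. ring.
Qed.

Lemma r_pow_lt_1 (n : nat) : r ^ S n < 1.
Proof.
  apply pow_lt_1_compat; [|lia]. destruct (exp_lam_unit lam lam_pos). lra.
Qed.

Lemma inv_ch_nome (n : nat) : / cosh (lam * IZR (Z.of_nat n)) = 2 * r ^ n / (1 + q ^ n).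
Proof.
  assert (0 < r ^ n) by (apply pow_lt, exp_pos).
  unfold cosh. rewrite exp_Ropp, exp_lam_index, Rpow_mult_distr.
  field. nra.
Qed.

Lemma inv_sh_nome (n : nat) : / sinh (lam * IZR (Z.of_nat (S n))) = 2 * r ^ S n / (1 - q ^ S n).
Proof.
  assert (0 < r ^ S n) by (apply pow_lt, exp_pos). assert (h := r_pow_lt_1 n).
  unfold sinh. rewrite exp_Ropp, exp_lam_index, Rpow_mult_distr.
  field. repeat split; nra.
Qed.

Lemma even_odd_false (i : nat) : Z.odd (Z.of_nat (2 * i)) = false.
Proof. rewrite Nat2Z.inj_mul, Z.odd_mul. reflexivity. Qed.

Lemma zsum_even_odd (f : Z -> R) : decays f ->
  zsum f = Series (fun i => pairs f (2 * i) + pairs f (2 * i + 1)).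
Proof.
  intros h. symmetry. apply is_series_unique.
  apply (is_series_even_odd (pairs f)), decays_is_series, h.
Qed.

Lemma dn_fun_0 : dn_fun lam 0 = dn_nome q.
Proof.
  unfold dn_fun. rewrite zsum_even_odd.
  - apply Series_ext. intros i. 
    assert (e1 : forall k, theta_coef lam k * cos (IZR k * 0) = theta_coef lam k).
    { intros k. rewrite Rmult_0_r, cos_0. ring. }
    rewrite !(pairs_ext _ _ e1).
    assert (e2 : pairs (theta_coef lam) (2 * i + 1) = 0).
    { replace (2 * i + 1)%nat with (S (2 * i)) by lia. unfold pairs.
      rewrite theta_coef_opp by assumption.
      replace (S (2 * i)) with (2 * i + 1)%nat by lia. rewrite odd_of_nat_odd. ring. }
    rewrite e2, Rplus_0_r. destruct i as [|i].
    + simpl. unfold theta_coef. simpl. rewrite Rmult_0_r, cosh_0. apply Rinv_1.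
    + unfold dn_term. unfold pairs.
      assert (h := even_odd_false (S i)).
      replace (2 * S i)%nat with (S (2 * i + 1)) in * by lia.
      rewrite theta_coef_opp, h by assumption.
      unfold theta_coef. rewrite h, inv_ch_nome.
      replace (S (2 * i + 1)) with (2 * S i)%nat by lia.
      rewrite (pow_mult r 2 (S i)). replace (r ^ 2) with q by ring.
      unfold Rdiv. ring.
  - apply (decays_mult_bounded (theta_coef lam) (fun k => cos (IZR k * 0))).
    + intros; apply Rabs_cos_le_1.
    + apply decays_theta, lam_pos.
Qed.

Lemma r_odd_power (i : nat) : r ^ (2 * i + 1) = r * q ^ i.
Proof. rewrite pow_add, pow_mult, pow_1. replace (r ^ 2) with q by ring. ring. Qed.

Lemma cn_fun_0 : cn_fun lam 0 = 4 * r * cn_nome q.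
Proof.
  unfold cn_fun, cn_nome. rewrite <- Series_scal_l, zsum_even_odd.
  - apply Series_ext. intros i.
    assert (e1 : forall k, cn_coef lam k * cos (IZR k * 0) = cn_coef lam k).
    { intros k. rewrite Rmult_0_r, cos_0. ring. }
    rewrite !(pairs_ext _ _ e1).
    assert (e2 : pairs (cn_coef lam) (2 * i) = 0).
    { assert (h := even_odd_false i). unfold pairs, cn_coef.
      destruct (2 * i)%nat; rewrite ?Z.odd_opp; simpl in h |- *; rewrite ?h; ring. }
    rewrite e2, Rplus_0_l.
    assert (h := odd_of_nat_odd i). replace (2 * i + 1)%nat with (S (2 * i)) in h |- * by lia.
    unfold pairs. rewrite cn_coef_opp. unfold cn_coef. rewrite h, inv_ch_nome.
    replace (S (2 * i)) with (2 * i + 1)%nat by lia.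
    rewrite r_odd_power. unfold cn_term, Rdiv. ring.
  - apply (decays_mult_bounded (cn_coef lam) (fun k => cos (IZR k * 0))).
    + intros; apply Rabs_cos_le_1.
    + apply decays_cn, lam_pos.
Qed.

Lemma quarter_sign_odd_nat (i : nat) : quarter_sign (Z.of_nat (2 * i + 1)) = (-1) ^ i.
Proof.
  induction i as [|i IH].
  - apply quarter_sign_1.
  - replace (Z.of_nat (2 * S i + 1)) with (Z.of_nat (2 * i + 1) + 2)%Z by lia.
    rewrite quarter_sign_add_2, IH. simpl. ring.
Qed.

Lemma sn_fun_PI2 : sn_fun lam (PI / 2) = 4 * r * sn_nome q.
Proof.
  replace (PI / 2) with (0 + PI / 2) by ring.
  rewrite sn_fun_quarter by assumption. unfold sn_nome. rewrite <- Series_scal_l, zsum_even_odd.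
  - apply Series_ext. intros i.
    assert (e1 : forall k, quarter_coef lam k * cos (IZR k * 0) = quarter_coef lam k).
    { intros k. rewrite Rmult_0_r, cos_0. ring. }
    rewrite !(pairs_ext _ _ e1).
    assert (e2 : pairs (quarter_coef lam) (2 * i) = 0).
    { assert (h := quarter_sign_even _ (even_odd_false i)). unfold pairs, quarter_coef.
      destruct (2 * i)%nat.
      - simpl in h |- *. rewrite h. ring.
      - rewrite quarter_sign_opp, h. ring. }
    rewrite e2, Rplus_0_l.
    assert (h := odd_of_nat_odd i). assert (h' := quarter_sign_odd_nat i).
    replace (2 * i + 1)%nat with (S (2 * i)) in h, h' |- * by lia.
    unfold pairs. rewrite quarter_coef_opp by assumption. unfold quarter_coef, theta_coef.
    rewrite h, h', inv_sh_nome.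
    replace (S (2 * i)) with (2 * i + 1)%nat by lia.
    rewrite r_odd_power. unfold sn_term, Rdiv. ring.
  - apply (decays_mult_bounded (quarter_coef lam) (fun k => cos (IZR k * 0))).
    + intros; apply Rabs_cos_le_1.
    + apply decays_quarter, lam_pos.
Qed.

End Nome.

Lemma tuned_parameter : exists lam, 0 < lam /\
  nome_low <= exp (- lam) * exp (- lam) <= nome_high /\
  0 < dn_fun lam 0 /\ 0 < cn_fun lam 0 /\ 0 < sn_fun lam (PI / 2) /\
  speed lam = 3.2 / PI.
Proof.
  destruct nome_exists as [q [hq e]].
  assert (hs : 0 < q <= 5 / 1000) by (unfold nome_low, nome_high in hq; lra).
  (* So that q = exp (- 2 lam). *)
  set (lam := - ln q / 2).
  assert (hl : 0 < lam).
  { unfold lam. assert (ln q < 0) by (rewrite <- ln_1; apply ln_increasing; lra). lra. }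
  assert (hr : exp (- lam) * exp (- lam) = q).
  { rewrite <- exp_plus. unfold lam. replace (- (- ln q / 2) + - (- ln q / 2)) with (ln q) by field.
    apply exp_ln. lra. }
  exists lam. unfold speed. rewrite dn_fun_0, cn_fun_0, sn_fun_PI2, hr by assumption.
  assert (h0 := exp_pos (- lam)).
  assert (hD := dn_nome_pos q hs). assert (hC := cn_nome_pos q hs). assert (hS := sn_nome_pos q hs).
  assert (hP := PI_RGT_0).
  repeat split; try tauto; try nra.
  apply (Rmult_eq_reg_l (PI * sn_nome q)); [|nra].
  transitivity (PI * (dn_nome q * cn_nome q)); [field; lra|]. rewrite e. field. lra.
Qed.

(** * Fourier coefficients and their enclosures *)

Lemma Cmod_le_sum (z : C) : Cmod z <= Rabs (fst z) + Rabs (snd z).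
Proof.
  destruct z as [a b]. simpl fst. simpl snd.
  assert (e : ((a, b) : C) = (RtoC a + (0, b))%C).
  { unfold Cplus, RtoC. simpl. f_equal; ring. }
  rewrite e. eapply Rle_trans; [apply Cmod_triangle|].
  rewrite Cmod_R. apply Rplus_le_compat_l.
  unfold Cmod. simpl. replace (0 * (0 * 1) + b * (b * 1)) with (Rsqr b) by (unfold Rsqr; ring).
  rewrite sqrt_Rsqr_abs. lra.
Qed.

Lemma is_series_components (a : nat -> C) (l1 l2 : R) :
  is_series (fun n => fst (a n)) l1 -> is_series (fun n => snd (a n)) l2 ->
  @is_series C_AbsRing C_NormedModule a (l1, l2).
Proof.
  intros h1 h2. unfold is_series.
  assert (e : forall n, sum_n a n =
    (sum_n (fun n => fst (a n)) n, sum_n (fun n => snd (a n)) n)).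
  { induction n as [|n IH].
    - rewrite !sum_O. destruct (a 0%nat). reflexivity.
    - rewrite !sum_Sn, IH. reflexivity. }
  apply filterlim_locally. intros eps.
  assert (k1 := proj1 (filterlim_locally _ _) h1 eps).
  assert (k2 := proj1 (filterlim_locally _ _) h2 eps).
  generalize (filter_and _ _ k1 k2). apply filter_imp. intros n b.
  rewrite e. exact b.
Qed.

Lemma decays_bilateral (f : Z -> R) : decays f -> exists sp sn,
  is_series (fun k => f (Z.of_nat k)) sp /\
  is_series (fun k => f (- Z.of_nat (S k))%Z) sn /\ zsum f = sp + sn.
Proof.
  intros [K [eta [hK [heta hf]]]].
  assert (hg : decays f) by (exists K, eta; tauto).
  assert (h1 : ex_series (fun k => f (Z.of_nat k))).
  { apply (@ex_series_le R_AbsRing R_CompleteNormedModule _ (fun k => K * eta ^ k)).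
    - intros k. change (Rabs (f (Z.of_nat k)) <= K * eta ^ k).
      specialize (hf (Z.of_nat k)). rewrite Zabs2Nat.id in hf. exact hf.
    - eexists. apply is_series_geom_scal, heta. }
  assert (h2 : ex_series (fun k => f (- Z.of_nat (S k))%Z)).
  { apply (@ex_series_le R_AbsRing R_CompleteNormedModule _ (fun k => K * eta ^ k)).
    - intros k. change (Rabs (f (- Z.of_nat (S k))%Z) <= K * eta ^ k).
      eapply Rle_trans; [apply hf|]. apply Rmult_le_compat_l; [exact hK|].
      apply pow_le_antitone; [exact heta|lia].
    - eexists. apply is_series_geom_scal, heta. }
  exists (Series (fun k => f (Z.of_nat k))), (Series (fun k => f (- Z.of_nat (S k))%Z)).
  split; [apply Series_correct, h1|]. split; [apply Series_correct, h2|].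
  unfold zsum. rewrite Series_incr_1 by (apply decays_ex_series, hg).
  rewrite (Series_incr_1 (fun k => f (Z.of_nat k)) h1).
  rewrite Rplus_assoc, <- Series_plus; [reflexivity| |exact h2].
  apply (ex_series_incr_1 (fun k => f (Z.of_nat k))), h1.
Qed.

Lemma bilateral_of_zsum (f : Z -> C) (x : R) :
  decays (fun n => fst (f n)) -> decays (fun n => snd (f n)) ->
  zsum (fun n => fst (f n)) = x -> zsum (fun n => snd (f n)) = 0 ->
  is_bilateral_series f (RtoC x).
Proof.
  intros g1 g2 e1 e2.
  destruct (decays_bilateral _ g1) as [p1 [n1 [a1 [b1 s1]]]].
  destruct (decays_bilateral _ g2) as [p2 [n2 [a2 [b2 s2]]]].
  exists (p1, p2), (n1, n2). split; [|split].
  - apply is_series_components; assumption.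
  - apply is_series_components; assumption.
  - unfold RtoC, Cplus. simpl. f_equal; congruence.
Qed.

Lemma cos_IZR_shift_opp (n : Z) (a : R) : cos (IZR (- n) * a) = cos (IZR n * a).
Proof. rewrite opp_IZR, Ropp_mult_distr_l_reverse. apply cos_neg. Qed.

Lemma sin_IZR_shift_opp (n : Z) (a : R) : sin (IZR (- n) * a) = - sin (IZR n * a).
Proof. rewrite opp_IZR, Ropp_mult_distr_l_reverse. apply sin_neg. Qed.

Section Coefficients.
Variables lam theta : R.
Hypothesis lam_pos : 0 < lam.

(** The real and imaginary parts of
[(1 / (k cosh (lam k))) (- i) (1 + i ^ k) e^(i k theta)]. *)
Definition orbit_coef (k : Z) : C :=
  (angle_coef lam k * (sin (IZR k * theta) + sin (IZR k * (theta + PI / 2))),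
   - angle_coef lam k * (cos (IZR k * theta) + cos (IZR k * (theta + PI / 2)))).

Lemma orbit_coef_times_cis (t : R) (k : Z) :
  (orbit_coef k * cis (IZR k * t))%C =
  (angle_coef lam k * sin (IZR k * (t + theta)) + angle_coef lam k * sin (IZR k * (t + theta + PI / 2)),
   - (angle_coef lam k * cos (IZR k * (t + theta)) +
      angle_coef lam k * cos (IZR k * (t + theta + PI / 2)))).
Proof.
  unfold orbit_coef, cis, Cmult. simpl.
  replace (IZR k * (t + theta + PI / 2)) with (IZR k * t + IZR k * (theta + PI / 2)) by ring.
  rewrite (Rmult_plus_distr_l (IZR k) t theta), !sin_plus, !cos_plus.
  f_equal; ring.
Qed.

Lemma orbit_fourier :
  is_fourier_coeffs (fun t => orbit lam (t + theta)) orbit_coef.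
Proof.
  intros t.
  assert (gs : forall s, decays (fun k => angle_coef lam k * sin (IZR k * s))).
  { intros s. apply (decays_mult_bounded (angle_coef lam) (fun k => sin (IZR k * s))).
    - intros; apply Rabs_sin_le_1.
    - apply decays_angle, lam_pos. }
  assert (gc : forall s, decays (fun k => angle_coef lam k * cos (IZR k * s))).
  { intros s. apply (decays_mult_bounded (angle_coef lam) (fun k => cos (IZR k * s))).
    - intros; apply Rabs_cos_le_1.
    - apply decays_angle, lam_pos. }
  assert (e := orbit_coef_times_cis t).
  apply bilateral_of_zsum.
  - eapply decays_ext; [intros k; rewrite e; simpl; reflexivity|]. apply decays_plus; apply gs.
  - eapply decays_ext; [intros k; rewrite e; simpl; reflexivity|].
    apply (decays_ext (fun k => -(1) * (angle_coef lam k * cos (IZR k * (t + theta)) +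
      angle_coef lam k * cos (IZR k * (t + theta + PI / 2))))); [intros; ring|].
    apply decays_scal, decays_plus; apply gc.
  - erewrite zsum_ext; [|intros k; rewrite e; simpl; reflexivity].
    rewrite zsum_plus by apply gs. reflexivity.
  - erewrite zsum_ext; [|intros k; rewrite e; simpl; reflexivity].
    apply zsum_odd. intros k. rewrite angle_coef_opp, !cos_IZR_shift_opp. ring.
Qed.

Lemma orbit_coef_opp (k : Z) : orbit_coef (- k) = Cconj (orbit_coef k).
Proof.
  unfold orbit_coef, Cconj. simpl.
  rewrite angle_coef_opp, !cos_IZR_shift_opp, !sin_IZR_shift_opp. f_equal; ring.
Qed.

Lemma orbit_coef_even (k : Z) : Z.odd k = false -> orbit_coef k = RtoC 0.
Proof.
  intros h. unfold orbit_coef. rewrite angle_coef_even by assumption.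
  unfold RtoC. f_equal; ring.
Qed.

(** [1 + i ^ k] has modulus [sqrt 2] for odd [k]. The exact modulus matters at
index 7, where the sum of the absolute values of the two parts may exceed the
allowed error. *)
Lemma orbit_coef_mod (k : Z) : Z.odd k = true ->
  Cmod (orbit_coef k) = sqrt 2 * Rabs (angle_coef lam k).
Proof.
  intros hk. unfold Cmod, orbit_coef. simpl fst. simpl snd.
  rewrite <- sqrt_Rsqr_abs, <- sqrt_mult by (lra || apply Rle_0_sqr). f_equal.
  assert (c0 := cos_odd_PI2 k hk).
  assert (s1 := sin2_cos2 (IZR k * theta)). assert (s2 := sin2_cos2 (IZR k * (PI / 2))).
  unfold Rsqr in *.
  rewrite (Rmult_plus_distr_l (IZR k)), sin_plus, cos_plus. rewrite c0 in *.
  set (a := sin (IZR k * theta)) in *. set (b := cos (IZR k * theta)) in *.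
  set (d := sin (IZR k * (PI / 2))) in *. set (m := angle_coef lam k).
  transitivity (m * m * ((a * a + b * b) * (1 + (d * d + 0 * 0)))); [ring|].
  rewrite s1, s2. ring.
Qed.

End Coefficients.

Lemma polar_angle (a b : R) : a ^ 2 + b ^ 2 = 1 -> exists th, cos th = a /\ sin th = b.
Proof.
  intros h. assert (ha : -1 <= a <= 1) by nra.
  assert (hs : sin (acos a) = Rabs b).
  { rewrite sin_acos by assumption. rewrite <- sqrt_Rsqr_abs. f_equal. unfold Rsqr. nra. }
  destruct (Rle_dec 0 b) as [l|l].
  - exists (acos a). rewrite cos_acos, hs, Rabs_pos_eq by assumption. auto.
  - exists (- acos a). rewrite cos_neg, sin_neg, cos_acos, hs, Rabs_left by lra. split; ring.
Qed.

Lemma sin_3 (x : R) : sin (3 * x) = 3 * cos x ^ 2 * sin x - sin x ^ 3.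
Proof.
  replace (3 * x) with (x + x + x) by ring. rewrite !sin_plus, !cos_plus. ring.
Qed.

Lemma cos_3 (x : R) : cos (3 * x) = cos x ^ 3 - 3 * cos x * sin x ^ 2.
Proof.
  replace (3 * x) with (x + x + x) by ring. rewrite !cos_plus, !sin_plus. ring.
Qed.

Lemma sin_5 (x : R) : sin (5 * x) = 5 * cos x ^ 4 * sin x - 10 * cos x ^ 2 * sin x ^ 3 + sin x ^ 5.
Proof.
  replace (5 * x) with (3 * x + x + x) by ring.
  rewrite !sin_plus, !cos_plus, sin_3, cos_3. ring.
Qed.

Lemma cos_5 (x : R) : cos (5 * x) = cos x ^ 5 - 10 * cos x ^ 3 * sin x ^ 2 + 5 * cos x * sin x ^ 4.
Proof.
  replace (5 * x) with (3 * x + x + x) by ring.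
  rewrite !cos_plus, !sin_plus, sin_3, cos_3. ring.
Qed.

Section Numerics.
Variable lam : R.
Hypothesis lam_pos : 0 < lam.
Notation r := (exp (- lam)).
Notation q := (r * r).
Hypothesis nome_range : nome_low <= q <= nome_high.

Notation Y := (-0.1163508047).
Definition first_coef : R := 2 * r / (1 + q).
(** The real part that the first coefficient must have once its imaginary part
is prescribed: the squared modulus of the coefficient is
[2 * first_coef ^ 2], and the negative root is the one close to -0.1521. *)
Definition first_re : R := - sqrt (2 * first_coef ^ 2 - Y ^ 2).

Lemma angle_coef_nat (n : nat) : Z.odd (Z.of_nat n) = true ->
  angle_coef lam (Z.of_nat n) = 2 * r ^ n / (1 + q ^ n) / INR n.
Proof.
  intros h. unfold angle_coef, cn_coef. rewrite h, inv_ch_nome by assumption.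
  rewrite <- INR_IZR_INZ. reflexivity.
Qed.

Lemma first_coef_sqr : first_coef ^ 2 = 4 * q / (1 + q) ^ 2.
Proof. unfold first_coef. assert (0 < r) by apply exp_pos. field. nra. Qed.

Lemma first_re_sqr : (0.1521 - 0.00000006) ^ 2 <= 2 * first_coef ^ 2 - Y ^ 2 <= (0.1521 + 0.00000006) ^ 2.
Proof.
  rewrite first_coef_sqr. unfold nome_low, nome_high in nome_range. generalize dependent q. intros p hp.
  assert (h : 0 < (1 + p) ^ 2) by (apply pow_lt; lra).
  split.
  - assert (((0.1521 - 0.00000006) ^ 2 + Y ^ 2) / 8 <= p / (1 + p) ^ 2).
    { apply (Rle_div_r _ _ ((1 + p) ^ 2)); nra. }
    unfold Rdiv in *. lra.
  - assert (p / (1 + p) ^ 2 <= ((0.1521 + 0.00000006) ^ 2 + Y ^ 2) / 8).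
    { apply (Rle_div_l _ _ ((1 + p) ^ 2)); nra. }
    unfold Rdiv in *. lra.
Qed.

Lemma first_re_bounds : -0.1521 - 0.00000006 <= first_re <= -0.1521 + 0.00000006.
Proof.
  assert (h := first_re_sqr). unfold first_re.
  set (s := 2 * first_coef ^ 2 - Y ^ 2) in *.
  assert (h0 := sqrt_pos s). assert (h1 : sqrt s ^ 2 = s) by (apply pow2_sqrt; lra).
  split; nra.
Qed.

Lemma first_re_circle : first_re ^ 2 + Y ^ 2 = 2 * first_coef ^ 2.
Proof.
  unfold first_re. assert (h := first_re_sqr). set (s := 2 * first_coef ^ 2 - Y ^ 2) in *.
  replace ((- sqrt s) ^ 2) with (sqrt s ^ 2) by ring. rewrite pow2_sqrt by lra.
  unfold s. ring.
Qed.

Lemma first_coef_pos : 0 < first_coef.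
Proof. unfold first_coef. assert (0 < r) by apply exp_pos. apply Rdiv_lt_0_compat; nra. Qed.

Lemma phase_exists : exists theta, first_coef * cos theta = (first_re - Y) / 2 /\ first_coef * sin theta = (first_re + Y) / 2.
Proof.
  assert (h := first_coef_pos). assert (e := first_re_circle).
  destruct (polar_angle ((first_re - Y) / (2 * first_coef)) ((first_re + Y) / (2 * first_coef))) as [th [h1 h2]].
  - transitivity ((first_re ^ 2 + Y ^ 2) / (2 * first_coef ^ 2)); [field; lra|]. rewrite e. field. lra.
  - exists th. rewrite h1, h2. split; field; lra.
Qed.

Variable theta : R.
Hypothesis theta_cos : first_coef * cos theta = (first_re - Y) / 2.
Hypothesis theta_sin : first_coef * sin theta = (first_re + Y) / 2.

Lemma cos_quarter : cos (theta + PI / 2) = - sin theta.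
Proof. rewrite cos_plus, cos_PI2, sin_PI2. ring. Qed.

Lemma sin_quarter : sin (theta + PI / 2) = cos theta.
Proof. rewrite sin_plus, cos_PI2, sin_PI2. ring. Qed.

Lemma orbit_coef_1 : orbit_coef lam theta 1 = (first_re, Y).
Proof.
  unfold orbit_coef. change 1%Z with (Z.of_nat 1). rewrite (angle_coef_nat 1 eq_refl).
  rewrite <- !INR_IZR_INZ. simpl INR. rewrite !Rmult_1_l, cos_quarter, sin_quarter, !pow_1.
  fold first_coef. f_equal.
  - transitivity (first_coef * sin theta + first_coef * cos theta); [field|]. rewrite theta_cos, theta_sin. field.
  - transitivity (first_coef * sin theta - first_coef * cos theta); [field|]. rewrite theta_cos, theta_sin. field.
Qed.

(** [k] is [1 / (3 cosh (3 lam))] divided by [first_coef ^ 3]; the powers of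
[exp (- lam)] cancel, and what remains is rational in the nome. The two
polynomials are combinations of the real and imaginary parts of
[(u + i v) ^ 3], where [u + i v] is [first_coef] times [e^(i theta)]. *)
Lemma orbit_coef_3 : orbit_coef lam theta 3 =
  let k := (1 + q) ^ 3 / (12 * (1 + q ^ 3)) in
  let u := (first_re - Y) / 2 in let v := (first_re + Y) / 2 in
  (k * (3 * u ^ 2 * v - v ^ 3 - (u ^ 3 - 3 * u * v ^ 2)),
   - (k * (3 * u ^ 2 * v - v ^ 3 + (u ^ 3 - 3 * u * v ^ 2)))).
Proof.
  cbv zeta. set (k := (1 + q) ^ 3 / (12 * (1 + q ^ 3))).
  unfold orbit_coef. change 3%Z with (Z.of_nat 3). rewrite (angle_coef_nat 3 eq_refl).
  rewrite <- !INR_IZR_INZ. replace (INR 3) with 3 by (simpl; ring).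
  rewrite !sin_3, !cos_3, cos_quarter, sin_quarter.
  assert (hr : 0 < r) by apply exp_pos.
  assert (hq : 0 < q) by nra. assert (0 < q ^ 3) by (apply pow_lt, hq).
  assert (e : 2 * r ^ 3 / (1 + q ^ 3) / 3 = k * first_coef ^ 3).
  { unfold k, first_coef. field. split; nra. }
  rewrite <- theta_cos, <- theta_sin, e. f_equal; ring.
Qed.

Lemma orbit_coef_5 : orbit_coef lam theta 5 =
  let k := (1 + q) ^ 5 / (80 * (1 + q ^ 5)) in
  let u := (first_re - Y) / 2 in let v := (first_re + Y) / 2 in
  (k * (5 * u ^ 4 * v - 10 * u ^ 2 * v ^ 3 + v ^ 5 + (u ^ 5 - 10 * u ^ 3 * v ^ 2 + 5 * u * v ^ 4)),
   k * (5 * u ^ 4 * v - 10 * u ^ 2 * v ^ 3 + v ^ 5 - (u ^ 5 - 10 * u ^ 3 * v ^ 2 + 5 * u * v ^ 4))).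
Proof.
  cbv zeta. set (k := (1 + q) ^ 5 / (80 * (1 + q ^ 5))).
  unfold orbit_coef. change 5%Z with (Z.of_nat 5). rewrite (angle_coef_nat 5 eq_refl).
  rewrite <- !INR_IZR_INZ. replace (INR 5) with 5 by (simpl; ring).
  rewrite !sin_5, !cos_5, cos_quarter, sin_quarter.
  assert (hr : 0 < r) by apply exp_pos.
  assert (hq : 0 < q) by nra. assert (0 < q ^ 5) by (apply pow_lt, hq).
  assert (e : 2 * r ^ 5 / (1 + q ^ 5) / 5 = k * first_coef ^ 5).
  { unfold k, first_coef. field. split; nra. }
  rewrite <- theta_cos, <- theta_sin, e. f_equal; ring.
Qed.

(** The error of [k] is not reduced by the small size of [P]; the tolerances
leave room for that. *)
Lemma product_near (k k0 P t dk dt : R) :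
  Rabs (k - k0) <= dk -> Rabs (k0 * P - t) <= dt -> Rabs P <= 1 -> Rabs (k * P - t) <= dk + dt.
Proof.
  intros h1 h2 h3. replace (k * P - t) with ((k - k0) * P + (k0 * P - t)) by ring.
  eapply Rle_trans; [apply Rabs_triang|]. rewrite Rabs_mult.
  generalize (Rabs_pos (k - k0)), (Rabs_pos P). nra.
Qed.

(** Complex multiplication contracts errors here: the factors are so small that
an error [d] in each of them becomes at most [0.6 * d] in the product, and the
rest of [d'] pays for rounding the product to the decimals [p], [p']. *)
Lemma cmul_near (d d' x y x' y' x0 y0 x0' y0' p p' : R) :
  Rabs (x - x0) <= d -> Rabs (y - y0) <= d -> Rabs (x' - x0') <= d -> Rabs (y' - y0') <= d ->
  Rabs x0 <= 0.135 -> Rabs y0 <= 0.135 -> Rabs x0' <= 0.135 -> Rabs y0' <= 0.135 ->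
  d <= 0.01 ->
  Rabs (x0 * x0' - y0 * y0' - p) <= d' - 0.6 * d ->
  Rabs (x0 * y0' + y0 * x0' - p') <= d' - 0.6 * d ->
  Rabs (x * x' - y * y' - p) <= d' /\ Rabs (x * y' + y * x' - p') <= d'.
Proof.
  intros h1 h2 h3 h4 b1 b2 b3 b4 hd r1 r2.
  assert (mul : forall s t s0 t0, Rabs (s - s0) <= d -> Rabs (t - t0) <= d ->
    Rabs s0 <= 0.135 -> Rabs t0 <= 0.135 -> Rabs (s * t - s0 * t0) <= 0.3 * d).
  { intros s t s0 t0 k1 k2 k3 k4.
    replace (s * t - s0 * t0) with (s0 * (t - t0) + (s - s0) * t0 + (s - s0) * (t - t0)) by ring.
    assert (g1 := Rabs_pos (s - s0)). assert (g2 := Rabs_pos (t - t0)).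
    assert (g3 := Rabs_pos s0). assert (g4 := Rabs_pos t0).
    eapply Rle_trans; [apply Rabs_triang|].
    eapply Rle_trans; [apply Rplus_le_compat_r, Rabs_triang|].
    rewrite !Rabs_mult.
    assert (Rabs s0 * Rabs (t - t0) <= 0.135 * d) by nra.
    assert (Rabs (s - s0) * Rabs t0 <= d * 0.135) by nra.
    assert (Rabs (s - s0) * Rabs (t - t0) <= d * 0.01) by nra. lra. }
  assert (m1 := mul x x' x0 x0' h1 h3 b1 b3). assert (m2 := mul y y' y0 y0' h2 h4 b2 b4).
  assert (m3 := mul x y' x0 y0' h1 h4 b1 b4). assert (m4 := mul y x' y0 x0' h2 h3 b2 b3).
  apply Rabs_le_between in m1, m2, m3, m4, r1, r2.
  split; apply Rabs_le; lra.
Qed.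

Lemma factor_3 : Rabs ((1 + q) ^ 3 / (12 * (1 + q ^ 3)) - 0.0844953106) <= 0.000000001.
Proof.
  unfold nome_low, nome_high in nome_range. generalize dependent q. intros p hp.
  assert (hl : 0.004626503 ^ 3 <= p ^ 3) by (apply pow_incr; lra).
  assert (hu : p ^ 3 <= 0.004626505 ^ 3) by (apply pow_incr; lra).
  assert (gl : (1 + 0.004626503) ^ 3 <= (1 + p) ^ 3) by (apply pow_incr; lra).
  assert (gu : (1 + p) ^ 3 <= (1 + 0.004626505) ^ 3) by (apply pow_incr; lra).
  set (a := (1 + p) ^ 3) in *. set (b := p ^ 3) in *.
  assert (a / (12 * (1 + b)) <= 0.0844953106 + 0.000000001) by (apply (Rle_div_l a); lra).
  assert (0.0844953106 - 0.000000001 <= a / (12 * (1 + b)))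
    by (apply (Rle_div_r (0.0844953106 - 0.000000001)); lra).
  apply Rabs_le. lra.
Qed.

Lemma factor_5 : Rabs ((1 + q) ^ 5 / (80 * (1 + q ^ 5)) - 0.0127918445) <= 0.000000001.
Proof.
  unfold nome_low, nome_high in nome_range. generalize dependent q. intros p hp.
  assert (hl : 0.004626503 ^ 5 <= p ^ 5) by (apply pow_incr; lra).
  assert (hu : p ^ 5 <= 0.004626505 ^ 5) by (apply pow_incr; lra).
  assert (gl : (1 + 0.004626503) ^ 5 <= (1 + p) ^ 5) by (apply pow_incr; lra).
  assert (gu : (1 + p) ^ 5 <= (1 + 0.004626505) ^ 5) by (apply pow_incr; lra).
  set (a := (1 + p) ^ 5) in *. set (b := p ^ 5) in *.
  assert (a / (80 * (1 + b)) <= 0.0127918445 + 0.000000001) by (apply (Rle_div_l a); lra).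
  assert (0.0127918445 - 0.000000001 <= a / (80 * (1 + b)))
    by (apply (Rle_div_r (0.0127918445 - 0.000000001)); lra).
  apply Rabs_le. lra.
Qed.

Notation u := ((first_re - Y) / 2).
Notation v := ((first_re + Y) / 2).

Notation a2 := (u * u - v * v).
Notation b2 := (u * v + v * u).
Notation a3 := (a2 * u - b2 * v).
Notation b3 := (a2 * v + b2 * u).
Notation a5 := (a3 * a2 - b3 * b2).
Notation b5 := (a3 * b2 + b3 * a2).

(** The powers of [u + i v] are enclosed one multiplication at a time, with
rounding in between: this keeps the rational arithmetic small. *)
Lemma phase_square :
  Rabs (a2 - -0.0176969574) <= 0.00000002 /\ Rabs (b2 - 0.0047984501) <= 0.00000002.
Proof.
  assert (h := first_re_bounds).
  assert (hu : Rabs (u - -0.01787459765) <= 0.00000003) by (apply Rabs_le; lra).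
  assert (hv : Rabs (v - -0.13422540235) <= 0.00000003) by (apply Rabs_le; lra).
  apply (cmul_near 0.00000003 _ _ _ _ _ _ _ _ _ _ _ hu hv hu hv);
    try (apply Rabs_le; lra); lra.
Qed.

Lemma phase_cube :
  Rabs (a3 - 0.0009603999) <= 0.00000002 /\ Rabs (b3 - 0.0022896109) <= 0.00000002.
Proof.
  assert (h := first_re_bounds). destruct phase_square as [h1 h2].
  assert (hu : Rabs (u - -0.01787459765) <= 0.00000003) by (apply Rabs_le; lra).
  assert (hv : Rabs (v - -0.13422540235) <= 0.00000003) by (apply Rabs_le; lra).
  revert hu hv h1 h2. generalize u v a2 b2. intros x y x2 y2 hu hv h1 h2.
  assert (h1' : Rabs (x2 - -0.0176969574) <= 0.00000003) by lra.
  assert (h2' : Rabs (y2 - 0.0047984501) <= 0.00000003) by lra.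
  apply (cmul_near 0.00000003 _ _ _ _ _ _ _ _ _ _ _ h1' h2' hu hv);
    try (apply Rabs_le; lra); lra.
Qed.

Lemma phase_fifth :
  Rabs (a5 - -0.0000279827) <= 0.00000002 /\ Rabs (b5 - -0.0000359107) <= 0.00000002.
Proof.
  destruct phase_square as [h1 h2], phase_cube as [h3 h4].
  revert h1 h2 h3 h4. generalize a3 b3 a2 b2. intros x y x2 y2 h1 h2 h3 h4.
  apply (cmul_near 0.00000002 _ _ _ _ _ _ _ _ _ _ _ h3 h4 h1 h2);
    try (apply Rabs_le; lra); lra.
Qed.

Lemma Cmod_small (a b d e : R) : Rabs a <= d -> Rabs b <= d -> 2 * d <= e -> Cmod (a, b) <= e.
Proof. intros h1 h2 h3. eapply Rle_trans; [apply Cmod_le_sum|]. simpl. lra. Qed.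

Lemma error_1 : Cmod (orbit_coef lam theta 1 - chat 1) <= beta2 / (Rabs 1 + 1) ^ 2.
Proof.
  rewrite orbit_coef_1. unfold Cminus, Cplus, Copp, chat, chat_pos, beta2. simpl.
  eapply Rle_trans; [apply Cmod_le_sum|]. simpl. rewrite Rabs_R1.
  assert (h := first_re_bounds). rewrite Rplus_opp_r, Rabs_R0.
  assert (Rabs (first_re + - -0.1521000000) <= 0.00000006) by (apply Rabs_le; lra). lra.
Qed.

Lemma error_3 : Cmod (orbit_coef lam theta 3 - chat 3) <= beta2 / (Rabs 3 + 1) ^ 2.
Proof.
  rewrite orbit_coef_3. cbv zeta.
  assert (hk := factor_3). destruct phase_cube as [ha hb].
  replace (3 * u ^ 2 * v - v ^ 3 - (u ^ 3 - 3 * u * v ^ 2)) with (b3 - a3) by ring.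
  replace (3 * u ^ 2 * v - v ^ 3 + (u ^ 3 - 3 * u * v ^ 2)) with (b3 + a3) by ring.
  revert hk ha hb. generalize a3 b3 ((1 + q) ^ 3 / (12 * (1 + q ^ 3))). intros a b k hk ha hb.
  apply Rabs_le_between in ha, hb.
  unfold Cminus, Cplus, Copp, chat, chat_pos, beta2. cbn [fst snd].
  apply (Cmod_small _ _ (0.000000001 + 0.000000004)).
  - apply (product_near k 0.0844953106 _ 0.0001123121); [exact hk|apply Rabs_le; lra|apply Rabs_le; lra].
  - rewrite <- Ropp_plus_distr, Rabs_Ropp.
    replace (-0.0002746107) with (- (0.0002746107)) by lra.
    apply (product_near k 0.0844953106 _ 0.0002746107); [exact hk|apply Rabs_le; lra|apply Rabs_le; lra].
  - rewrite Rabs_pos_eq by lra. lra.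
Qed.

Lemma error_5 : Cmod (orbit_coef lam theta 5 - chat 5) <= beta2 / (Rabs 5 + 1) ^ 2.
Proof.
  rewrite orbit_coef_5. cbv zeta.
  assert (hk := factor_5). destruct phase_fifth as [ha hb].
  replace (5 * u ^ 4 * v - 10 * u ^ 2 * v ^ 3 + v ^ 5 + (u ^ 5 - 10 * u ^ 3 * v ^ 2 + 5 * u * v ^ 4))
    with (b5 + a5) by ring.
  replace (5 * u ^ 4 * v - 10 * u ^ 2 * v ^ 3 + v ^ 5 - (u ^ 5 - 10 * u ^ 3 * v ^ 2 + 5 * u * v ^ 4))
    with (b5 - a5) by ring.
  revert hk ha hb. generalize a5 b5 ((1 + q) ^ 5 / (80 * (1 + q ^ 5))). intros a b k hk ha hb.
  apply Rabs_le_between in ha, hb.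
  unfold Cminus, Cplus, Copp, chat, chat_pos, beta2. cbn [fst snd].
  apply (Cmod_small _ _ (0.000000001 + 0.000000001)).
  - apply (product_near k 0.0127918445 _ (-0.0000008173)); [exact hk|apply Rabs_le; lra|apply Rabs_le; lra].
  - apply (product_near k 0.0127918445 _ (-0.0000001014)); [exact hk|apply Rabs_le; lra|apply Rabs_le; lra].
  - rewrite Rabs_pos_eq by lra. lra.
Qed.

Lemma r_bound : 0 < r <= 0.06802.
Proof.
  split; [apply exp_pos|]. assert (0 < r) by apply exp_pos.
  unfold nome_low, nome_high in nome_range. nra.
Qed.

(** The decay of the coefficients beats the weight [(n + 1) ^ 2] of the norm at
[n = 7 + m]. *)
Lemma sqr_times_pow (m : nat) : (INR m + 8) ^ 2 * r ^ m <= 64.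
Proof.
  assert (hr := r_bound). induction m as [|m IH].
  - simpl. lra.
  - rewrite S_INR, <- tech_pow_Rmult.
    assert (0 <= INR m) by apply pos_INR. assert (0 < r ^ m) by (apply pow_lt; lra).
    assert (hs : (INR m + 1 + 8) ^ 2 <= 2 * (INR m + 8) ^ 2) by nra.
    assert (hA : 0 <= (INR m + 8) ^ 2) by apply pow2_ge_0.
    apply Rle_trans with (2 * (INR m + 8) ^ 2 * (r * r ^ m)).
    + apply Rmult_le_compat_r; [nra|exact hs].
    + assert (0 <= (INR m + 8) ^ 2 * r ^ m) by nra.
      replace (2 * (INR m + 8) ^ 2 * (r * r ^ m)) with (2 * r * ((INR m + 8) ^ 2 * r ^ m)) by ring.
      nra.
Qed.

Lemma sqrt_2_bound : sqrt 2 <= 1.4143.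
Proof.
  assert (h0 := sqrt_pos 2). assert (h := pow2_sqrt 2 ltac:(lra)). nra.
Qed.

(** The approximate sequence vanishes here, so the coefficient itself has to be
small; the worst case is [n = 7]. *)
Lemma error_tail (m : nat) : Z.odd (Z.of_nat (7 + m)) = true ->
  Cmod (orbit_coef lam theta (Z.of_nat (7 + m))) <= beta2 / (INR (7 + m) + 1) ^ 2.
Proof.
  intros h. rewrite orbit_coef_mod, angle_coef_nat by assumption.
  assert (hr := r_bound). assert (hm := sqr_times_pow m).
  assert (hI : INR (7 + m) = 7 + INR m) by (rewrite plus_INR; simpl; lra).
  assert (hn : 0 <= INR m) by apply pos_INR.
  assert (hp : 0 < r ^ (7 + m)) by (apply pow_lt; lra).
  assert (hq : 0 < q ^ (7 + m)) by (apply pow_lt; nra).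
  assert (hpm : 0 < r ^ m) by (apply pow_lt; lra).
  assert (h7 : r ^ 7 <= 0.06802 ^ 7) by (apply pow_incr; lra).
  rewrite hI. replace (7 + INR m + 1) with (INR m + 8) by ring.
  apply (Rle_div_r _ _ ((INR m + 8) ^ 2)); [nra|].
  assert (hc : 2 * r ^ (7 + m) / (1 + q ^ (7 + m)) / (7 + INR m) <= 2 * r ^ (7 + m) / 7).
  { apply (Rle_div_l (2 * r ^ (7 + m) / (1 + q ^ (7 + m)))); [lra|].
    apply Rle_trans with (2 * r ^ (7 + m)); [|unfold Rdiv; nra].
    apply (Rle_div_l (2 * r ^ (7 + m))); nra. }
  rewrite Rabs_pos_eq.
  2: { apply Rdiv_le_0_compat; [|lra]. apply Rdiv_le_0_compat; nra. }
  set (c := 2 * r ^ (7 + m) / (1 + q ^ (7 + m)) / (7 + INR m)) in *.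
  assert (hs := sqrt_2_bound). assert (hs0 := sqrt_pos 2).
  apply Rle_trans with (1.4143 * (2 * r ^ (7 + m) / 7) * (INR m + 8) ^ 2).
  { apply Rmult_le_compat_r; [nra|].
    apply Rle_trans with (sqrt 2 * (2 * r ^ (7 + m) / 7)); [nra|].
    apply Rmult_le_compat_r; lra. }
  rewrite pow_add.
  replace (1.4143 * (2 * (r ^ 7 * r ^ m) / 7) * (INR m + 8) ^ 2)
    with (1.4143 * 2 / 7 * r ^ 7 * ((INR m + 8) ^ 2 * r ^ m)) by field.
  assert (0 < r ^ 7) by (apply pow_lt; lra).
  apply Rle_trans with (1.4143 * 2 / 7 * 0.06802 ^ 7 * 64).
  - apply Rmult_le_compat; try nra. 
  - unfold beta2. lra.
Qed.

End Numerics.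

(** * Membership in X3 and conclusion *)

Lemma chat_opp (n : Z) : chat (- n) = Cconj (chat n).
Proof.
  destruct n as [|p|p]; simpl.
  - unfold Cconj, RtoC. simpl. f_equal. ring.
  - reflexivity.
  - rewrite Cconj_conj. reflexivity.
Qed.

Lemma chat_above_5 (m : nat) : chat (Z.of_nat (6 + m)) = RtoC 0.
Proof.
  destruct (Z.of_nat (6 + m)) as [|p|p] eqn:e; [reflexivity| |lia].
  simpl. destruct p as [[[p|p|]|[p|p|]|]|p|]; try reflexivity; lia.
Qed.

Lemma Cmod_C0_minus_C0 : Cmod (RtoC 0 - RtoC 0) = 0.
Proof. rewrite <- RtoC_minus, Rminus_0_r. apply Cmod_0. Qed.

Section Final_bounds.
Variables lam theta : R.
Hypothesis lam_pos : 0 < lam.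
Hypothesis nome_range : nome_low <= exp (- lam) * exp (- lam) <= nome_high.
Hypothesis theta_cos : first_coef lam * cos theta = (first_re lam + 0.1163508047) / 2.
Hypothesis theta_sin : first_coef lam * sin theta = (first_re lam - 0.1163508047) / 2.

Lemma error_bound_nonneg (n : nat) :
  Cmod (orbit_coef lam theta (Z.of_nat n) - chat (Z.of_nat n)) <=
  beta2 / (Rabs (IZR (Z.of_nat n)) + 1) ^ 2.
Proof.
  assert (tc : first_coef lam * cos theta = (first_re lam - -0.1163508047) / 2) by lra.
  assert (ts : first_coef lam * sin theta = (first_re lam + -0.1163508047) / 2) by lra.
  destruct (Z.odd (Z.of_nat n)) eqn:hn.
  - destruct n as [|[|[|[|[|[|[|n]]]]]]]; try discriminate hn.
    + apply error_1; assumption.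
    + apply error_3; assumption.
    + apply error_5; assumption.
    + change (S (S (S (S (S (S (S n))))))) with (6 + S n)%nat at 2.
      rewrite chat_above_5. rewrite <- INR_IZR_INZ, (Rabs_pos_eq (INR _)) by apply pos_INR.
      change (S (S (S (S (S (S (S n))))))) with (7 + n)%nat.
      unfold Cminus. rewrite Copp_0, Cplus_0_r. apply error_tail; assumption.
  - rewrite orbit_coef_even by assumption.
    assert (e : chat (Z.of_nat n) = RtoC 0).
    { destruct n as [|[|[|[|[|[|n]]]]]]; try reflexivity; try discriminate hn.
      apply (chat_above_5 n). }
    rewrite e, Cmod_C0_minus_C0.
    apply Rdiv_le_0_compat; [unfold beta2; lra|].
    apply pow_lt. generalize (Rabs_pos (IZR (Z.of_nat n))). lra.
Qed.

Lemma orbit_coef_X3 : X3 (orbit_coef lam theta).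
Proof.
  assert (sym : forall n, (orbit_coef lam theta (- n) - chat (- n))%C =
    Cconj (orbit_coef lam theta n - chat n)).
  { intros n. rewrite orbit_coef_opp, chat_opp.
    unfold Cconj, Cminus, Cplus, Copp. simpl. f_equal; ring. }
  split.
  - exists (fun n => (orbit_coef lam theta n - chat n)%C). split.
    + intros n. split.
      * destruct (Z_le_dec 0 n) as [l|l].
        -- rewrite <- (Z2Nat.id n l). apply error_bound_nonneg.
        -- rewrite <- (Z.opp_involutive n). rewrite sym, Cmod_conj.
           rewrite (opp_IZR (- n)), Rabs_Ropp.
           rewrite <- (Z2Nat.id (- n)) by lia. apply error_bound_nonneg.
      * rewrite sym, Cconj_conj. reflexivity.
    + intros n. unfold Cminus. ring.
  - rewrite orbit_coef_1 by (assumption || lra). unfold chat, chat_pos, Im.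
    simpl. lra.
Qed.

End Final_bounds.

Theorem theorem3 (K : R) (hK : K = 1.6) :
  exists (tau : R) (x : R -> R),
    tau_lower <= tau <= tau_upper /\
    is_periodic (2 * PI) x /\
    is_C1 x /\
    (forall t : R, is_derive x t (- (K / tau) * sin (x (t - tau)))) /\
    (exists c : Z -> C, is_fourier_coeffs x c /\ X3 c).
Proof.
  destruct tuned_parameter as [lam [hl [hq [hD [hC [hS hA]]]]]].
  destruct (phase_exists lam hq) as [theta [h1 h2]].
  set (x := fun t => orbit lam (t + theta)).
  assert (hx : forall t, is_derive x t (- (K / (PI / 2)) * sin (x (t - PI / 2)))).
  { intros t. replace (K / (PI / 2)) with (speed lam).
    2: { rewrite hA, hK. replace 3.2 with (2 * 1.6) by lra. field. apply PI_neq0. }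
    unfold x. replace (t - PI / 2 + theta) with (t + theta - PI / 2) by ring.
    evar_last.
    - apply (is_derive_comp (orbit lam) (fun t => t + theta)).
      + apply orbit_derive; assumption.
      + apply (is_derive_plus (K:=R_AbsRing) (V:=R_NormedModule));
          [apply is_derive_id|apply is_derive_const].
    - unfold plus, scal, one, zero; simpl; unfold mult; simpl. ring. }
  exists (PI / 2), x. split; [|split; [|split; [|split]]].
  - assert (p := PI_bounds). unfold tau_lower, tau_upper, tau_hat, Delta_tau. lra.
  - intros t. unfold x. replace (t + 2 * PI + theta) with (t + theta + 2 * PI) by ring.
    apply orbit_periodic.
  - intros t. split; [eexists; apply hx|].
    apply (continuous_ext (fun t => - (K / (PI / 2)) * sin (x (t - PI / 2)))).
    + intros s. symmetry. apply (is_derive_unique x s), hx.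
    + apply (ex_derive_continuous (K:=R_AbsRing) (V:=R_NormedModule)
        (fun t => - (K / (PI / 2)) * sin (x (t - PI / 2)))).
      auto_derive. eexists. apply hx.
  - exact hx.
  - exists (orbit_coef lam theta). split.
    + apply orbit_fourier, hl.
    + apply orbit_coef_X3; (assumption || lra).
Qed.
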